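(* Let $a$ be a positive integer and $d_1,\dotsc,d_k$ positive integers, and let $D=D_a(d_1,\dotsc,d_k)$ be the generalized Douglas region described in the context. Let $h$ be the height of $D$, let $m$ (resp. $n$) be the number of rows of up-pointing (resp. down-pointing) triangular black cells in $D$, and let $C$ be the number of black cells of $D$ that are not down-pointing triangles. (a) If the bottom row of cells of $D$ is black, or if $h\neq a+m-n$, then $\mathrm{M}(D)=0$. (b) If $h=a+m-n$ and the bottom row of cells of $D$ is white, then \[ \mathrm{M}(D)=2^{C-h(h+1)}\,2^{h(h+1)/2}=2^{C-h(h+1)/2}, \] where $2^{h(h+1)/2}$ is the number of domino tilings of the Aztec diamond of order $h$.
   Context: Work with the square lattice $\mathbb{Z}^2$. A ''diagonal'' is a line $y=x+c$, $c\in\mathbb{Z}$; consecutive diagonals are at distance $\sqrt2/2$, the unit for distances between diagonals. Fix a diagonal $\ell$. Draw in $\ell$ and $k$ diagonals above $\ell$ whose successive distances, starting from the top, are $d_1,\dotsc,d_k$ ($d_k$ = distance from the lowest of them to $\ell$). The drawn diagonals dissect the lattice into fundamental regions (unit squares not crossed by a drawn diagonal, and half-square triangles). Color them black and white so that regions sharing an edge have opposite colors, with the triangles just below the top drawn diagonal white. Construction of $D_a(d_1,\dotsc,d_k)$: let $A$ be a lattice point on the top drawn diagonal; from $A$ take unit steps south or east so that the fundamental region on the left of each step (relative to the direction of motion) is black, until reaching a point $B$ on $\ell$. Let $F=A+(a,a)$; from $F$ take unit steps south or east so that the region on the left of each step is white, until reaching a point $E$ on $\ell$. The region is bounded by segment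 $AF$, path $F\to E$, segment $EB$ of $\ell$, and path $B\to A$; the two paths are assumed not to intersect. Its cells are the fundamental regions inside it. A triangular cell is down-pointing if it points towards $\ell$ and up-pointing if it points away from $\ell$. A row of cells is either the set of all triangular cells of a given color with bases on a fixed lattice diagonal, or the set of all square cells of a given color crossed by a fixed lattice diagonal. The height of $D$ is the number of rows of black cells that are squares or up-pointing triangles. The bottom row of cells is the row of triangular cells with bases on $\ell$. A tile is a union of two cells sharing an edge, and $\mathrm{M}(R)$ is the number of tilings of $R$. *)

(* Defs.v *)
From HB Require Import structures.
From mathcomp Require Import all_boot all_order all_algebra finmap zify.
Set Implicit Arguments.
Unset Strict Implicit.
Unset Printing Implicit Defensive.
Import Order.TTheory GRing.Theory Num.Theory.
Local Open Scope ring_scope.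

(* Lattice points (x, y); the lattice diagonal through p is y = x + diag p.   *)
Definition point := (int * int)%type.
Definition diag (p : point) : int := p.2 - p.1.

(* Sq is a whole unit square, Up (resp. Dn) the half of a unit square lying   *)
(* above (resp. below) its diagonal of slope 1.                               *)
Variant shape := Sq | Up | Dn.

Definition shape_code (s : shape) : 'I_3 :=
  match s with Sq => @Ordinal 3 0 isT | Up => @Ordinal 3 1 isT
             | Dn => @Ordinal 3 2 isT end.
Definition shape_decode (i : 'I_3) : shape :=
  match val i with 0%N => Sq | 1%N => Up | _ => Dn end.
Lemma shape_codeK : cancel shape_code shape_decode. Proof. by case. Qed.
HB.instance Definition _ := Countable.copy shape (can_type shape_codeK).

(* (s, p) is carried by the unit square whose lower left corner is p.  That   *)
(* square is crossed by the diagonal y = x + diag p, which also contains the  *)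
(* base of each of its two halves.                                            *)
Definition cell := (shape * point)%type.
Definition cdiag (x : cell) : int := diag x.2.

Definition is_square (x : cell) : bool := x.1 == Sq.
Definition up_pointing (x : cell) : bool := x.1 == Up.
Definition down_pointing (x : cell) : bool := x.1 == Dn.

Definition vertices (x : cell) : seq point :=
  let: (s, (i, j)) := x in
  match s with
  | Sq => [:: (i, j); (i + 1, j); (i + 1, j + 1); (i, j + 1)]
  | Up => [:: (i, j); (i + 1, j + 1); (i, j + 1)]
  | Dn => [:: (i, j); (i + 1, j); (i + 1, j + 1)]
  end.

(* An edge is given by its two ends, the lower or left one first.             *)
Definition edges (x : cell) : seq (point * point) :=
  let: (s, (i, j)) := x in
  let west  := ((i, j), (i, j + 1)) in
  let south := ((i, j), (i + 1, j)) in
  let east  := ((i + 1, j), (i + 1, j + 1)) in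
  let north := ((i, j + 1), (i + 1, j + 1)) in
  let base  := ((i, j), (i + 1, j + 1)) in
  match s with
  | Sq => [:: west; south; east; north]
  | Up => [:: west; north; base]
  | Dn => [:: south; east; base]
  end.

Definition share_edge (x y : cell) : bool :=
  (x != y) && has (mem (edges x)) (edges y).

(* Tilings of a finite set of cells by unions of two cells sharing an edge.   *)
Section Tilings.
Local Open Scope fset_scope.

Definition is_tile (t : {fset cell}) : bool :=
  [exists x : t, exists y : t,
     share_edge (val x) (val y) && (t == [fset val x; val y])].

Definition is_tiling (R : {fset cell}) (T : {fset {fset cell}}) : bool :=
  [&& [forall t : T, is_tile (val t)], trivIfset T & fcover T == R].

Definition tilings (R : {fset cell}) : {fset {fset {fset cell}}} :=
  [fset T in fpowerset (fpowerset R) | is_tiling R T].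

Definition M (R : {fset cell}) : nat := #|` tilings R|.

End Tilings.

(* The drawn diagonals y = x + c, from the top one down to l : y = x + l.     *)
Definition drawn (l : int) (ds : seq nat) : seq int :=
  [seq l + (sumn (drop i ds))%:Z | i <- iota 0 (size ds).+1].
Definition top (l : int) (ds : seq nat) : int := l + (sumn ds)%:Z.

Definition fundamental (dr : seq int) (x : cell) : bool :=
  is_square x == (cdiag x \notin dr).

Definition proper_coloring (dr : seq int) (black : pred cell) : Prop :=
  forall x y, fundamental dr x -> fundamental dr y -> share_edge x y ->
    black x = ~~ black y.

Definition south_of (p : point) : point := (p.1, p.2 - 1).
Definition east_of (p : point) : point := (p.1 + 1, p.2).

(* The fundamental region on the left of the unit step south (resp. east)     *)
(* from p: it lies just east (resp. north) of the step.                       *)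
Definition left_of_south (dr : seq int) (p : point) : cell :=
  (if diag (south_of p) \in dr then Up else Sq, south_of p).
Definition left_of_east (dr : seq int) (p : point) : cell :=
  (if diag p \in dr then Dn else Sq, p).

(* A unit step south or east whose left region has colour b (true = black).   *)
Definition colored_step (dr : seq int) (black : pred cell) (b : bool)
    : rel point := fun p q =>
  (q == south_of p) && (black (left_of_south dr p) == b)
  || (q == east_of p) && (black (left_of_east dr p) == b).

(* Each step south or east lowers diag by 1, so a path from the top diagonal  *)
(* to l meets every lattice diagonal of the strip exactly once.  Hence a      *)
(* lattice point is in the closed region iff, along its own lattice diagonal, *)
(* it lies weakly right of the left path and weakly left of the right path.   *)
Definition between (left right : seq point) (p : point) : bool :=
  has (fun q => (diag q == diag p) && (q.1 <= p.1)) left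
  && has (fun q => (diag q == diag p) && (p.1 <= q.1)) right.

(* D_a(d_1, ..., d_k) together with the data of its construction; lpath and   *)
(* rpath are the paths A -> B and F -> E without their starting points.       *)
Record douglas_region (a : nat) (ds : seq nat) := DouglasRegion {
  ell : int;
  black : pred cell;
  ptA : point;
  lpath : seq point;
  rpath : seq point;
  region :> {fset cell};
  ptF := (ptA.1 + a%:Z, ptA.2 + a%:Z) : point;
  black_proper : proper_coloring (drawn ell ds) black;
  top_white : forall p, diag p = top ell ds -> ~~ black (Dn, p);
  ptA_top : diag ptA = top ell ds;
  lpath_black : path (colored_step (drawn ell ds) black true) ptA lpath;
  lpath_end : diag (last ptA lpath) = ell;
  rpath_white : path (colored_step (drawn ell ds) black false) ptF rpath;
  rpath_end : diag (last ptF rpath) = ell;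
  paths_disjoint : ~~ has (mem (ptA :: lpath)) (ptF :: rpath);
  regionE : forall x : cell, (x \in region) =
    fundamental (drawn ell ds) x
    && all (between (ptA :: lpath) (ptF :: rpath)) (vertices x)
}.

Section Statistics.
Local Open Scope fset_scope.
Variables (a : nat) (ds : seq nat) (D : douglas_region a ds).

Definition same_row (x y : cell) : bool :=
  [&& is_square x == is_square y, black D x == black D y & cdiag x == cdiag y].

Definition row_of (x : cell) : {fset cell} := [fset y in region D | same_row x y].

Definition nb_rows (P : pred cell) : nat :=
  #|` [fset row_of x | x in region D & P x]|.

Definition height : nat :=
  nb_rows (fun x => black D x && (is_square x || up_pointing x)).
Definition nb_up_rows : nat :=
  nb_rows (fun x => black D x && up_pointing x).
Definition nb_down_rows : nat :=
  nb_rows (fun x => black D x && down_pointing x).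

Definition nb_regular_black : nat :=
  #|` [fset x in region D | black D x && ~~ down_pointing x]|.

Definition bottom_row : {fset cell} :=
  [fset x in region D | ~~ is_square x && (cdiag x == ell D)].
Definition bottom_black : Prop := {in bottom_row, forall x, black D x}.
Definition bottom_white : Prop := {in bottom_row, forall x, ~~ black D x}.

End Statistics.

(* The Aztec diamond of order h: the unit squares inside |x| + |y| <= h + 1.  *)
(* Without half-squares, tiles are dominoes.                                  *)
Definition in_diamond (h : nat) (p : point) : bool :=
  `|p.1| + `|p.2| <= (h.+1)%:Z.

Definition aztec_range (h : nat) : seq int :=
  [seq i%:Z - (h.+1)%:Z | i <- iota 0 (2 * h.+1).+1].

Definition aztec_diamond (h : nat) : {fset cell} :=
  [fset x in [seq (Sq, (i, j)) | i <- aztec_range h, j <- aztec_range h]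
     | all (in_diamond h) (vertices x)]%fset.

Lemma mem_aztec_range (h : nat) (i : int) :
  (i \in aztec_range h) = (`|i| <= (h.+1)%:Z).
Proof.
apply/mapP/idP => [[n]|lei].
  by rewrite mem_iota => nlt ->; lia.
exists (absz (i + (h.+1)%:Z)); first by rewrite mem_iota; lia.
by lia.
Qed.

Lemma in_aztec_diamond (h : nat) (x : cell) :
  (x \in aztec_diamond h) = is_square x && all (in_diamond h) (vertices x).
Proof.
have -> : (x \in aztec_diamond h) =
    (x \in [seq (Sq, (i, j)) | i <- aztec_range h, j <- aztec_range h])
    && all (in_diamond h) (vertices x).
  by rewrite /aztec_diamond in_fset inE.
have [all_x|] := boolP (all _ _); last by rewrite !andbF.
rewrite !andbT; case: x all_x => s [i j] all_x.
apply/allpairsPdep/eqP => [[u [v [_ _ [-> _ _]]]] //|/= sE].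
subst s; exists i, j; split => //;
  rewrite mem_aztec_range; move: all_x; rewrite /= /in_diamond /=; lia.
Qed.

(* Main.v *)
(* Read a region row by row from the top.  A tiling is encoded by recording,  *)
(* in each white row, the cells matched downwards and, in each black row, the *)
(* cells matched upwards; call these cells particles.  Passing from a white   *)
(* row to the wider black row below moves each particle by half a unit and    *)
(* keeps their number (operator up); passing from a black row to the narrower *)
(* white row below does the same to the holes and so destroys one particle    *)
(* (operator down); crossing a drawn diagonal changes nothing.  Hence M(D) is *)
(* a matrix entry, from the full row of a particles to the empty row (the     *)
(* full one if the bottom row is black), of a word in up and down.  The       *)
(* commutation relation "up, then down" = 2 "down, then up" moves all the     *)
(* down steps to the front.  There the a particles vanish one at a time, so   *)
(* M(D) = 0 unless there are exactly a down steps, in which case M(D) =       *)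
(* 2^inv, inv being the number of pairs formed by an up step and a later down *)
(* step.  Summing the row widths identifies inv with C - h(h+1)/2, and h - m  *)
(* + n counts the down steps.  The Aztec diamond of order h is the word (up   *)
(* down)^h, with h particles.                                                 *)

Require Import Defs.
From mathcomp Require Import all_boot all_order all_algebra finmap zify.
Set Implicit Arguments.
Unset Strict Implicit.
Unset Printing Implicit Defensive.
Import Order.TTheory GRing.Theory Num.Theory.

(** * Tilings *)

(** The two boundary paths ask for opposite colours, so on each diagonal one goes east and the other
    south. Hence D is a stack of rows of alternating colour that gains a cell on entering a black
    row, loses one on entering a white row and keeps its width across a drawn diagonal ([path_rows],
    [region_rows]). Matching the rows off from the top turns [M D] into a matrix entry of a word in
    the operators [up] and [down] ([Mseq_strip], [M_stripE]).

    The heart is the relation [up_down]: both composites are governed by the same interlacing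
    condition on two rows of equal length, once with weight 2. So the word may be sorted, each
    inversion giving a factor 2 ([transferE]). The sorted word is evaluated by conservation of
    particles or holes: it gives 0 or 1 ([transfer_empty], [transfer_full]).

    It remains to count. The up steps are the [h] regular black rows, [count_rows_balance] finds the
    number of down steps, and [inversions_ops] obtains the exponent by summing row widths. The Aztec
    diamond is a strip of the same kind ([M_aztec_diamond]). *)

Section Deletion.
Local Open Scope fset_scope.
Implicit Types (R t : {fset cell}) (T : {fset {fset cell}}) (x y : cell).

Lemma share_edgeC x y : share_edge x y = share_edge y x.
Proof. by rewrite /share_edge eq_sym has_sym. Qed.

Lemma is_tileP t :
  reflect (exists x y, share_edge x y /\ t = [fset x; y]) (is_tile t).
Proof.
apply: (iffP existsP) => [[x /existsP[y /andP[xy /eqP tE]]]|[x [y [xy tE]]]].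
  by exists (val x), (val y).
have xt : x \in t by rewrite tE !inE eqxx.
have yt : y \in t by rewrite tE !inE eqxx orbT.
by exists [` xt]; apply/existsP; exists [` yt]; rewrite /= xy tE eqxx.
Qed.

Lemma tilingP R T :
  reflect [/\ forall t, t \in T -> is_tile t,
              {in T &, forall t t', t != t' -> [disjoint t & t']}
            & fcover T = R]
          (T \in tilings R).
Proof.
rewrite /tilings in_fset inE /=; apply: (iffP andP).
  case=> _ /and3P[/forallP tT /trivIfsetP trT /eqP cT]; split=> // t tin.
  exact: (tT [` tin]).
case=> tT trT cT; split.
  rewrite fpowersetE; apply/fsubsetP=> t tin; rewrite fpowersetE -cT.
  exact: bigfcup_sup.
apply/and3P; split; [|exact/trivIfsetP|exact/eqP].
by apply/forallP=> t; apply/tT/valP.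
Qed.

Lemma mem_fcover T x : reflect (exists2 t, t \in T & x \in t) (x \in fcover T).
Proof.
rewrite /fcover; apply: (iffP (bigfcupP _ _ _ _)) => [[t /andP[tT _] xt]|[t tT xt]]; first by exists t.
by exists t; rewrite ?tT.
Qed.

Lemma tiling_disjoint R T t t' x : T \in tilings R -> t \in T -> t' \in T ->
  x \in t -> x \in t' -> t = t'.
Proof.
case/tilingP=> _ trT _ tT t'T xt xt'; apply/eqP; apply: contraLR xt' => ntt'.
exact: (fdisjointP (trT _ _ tT t'T ntt')).
Qed.

Lemma M0 : M fset0 = 1%N.
Proof.
suff -> : M fset0 = #|` [fset fset0 : {fset {fset cell}}]| by rewrite cardfs1.
congr #|` _|; apply/fsetP=> T; rewrite inE; apply/tilingP/eqP => [[tT _ c0]|->].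
  apply/eqP; rewrite -[_ == _]negbK -/(_ != _); apply/negP => /fset0Pn[t tin].
  have /is_tileP[x [y [_ tE]]] := tT _ tin.
  have : x \in fcover T by apply/mem_fcover; exists t; rewrite // tE !inE eqxx.
  by rewrite c0 inE.
split=> //; apply/fsetP=> x; rewrite inE; apply/mem_fcover.
by case=> t; rewrite inE.
Qed.

(** Adding the tile [t] is a bijection from the tilings of the rest onto the tilings of [R] that use
    [t]. *)
Lemma card_tilings_with R t : is_tile t -> t `<=` R ->
  #|` [fset T in tilings R | t \in T]| = M (R `\` t).
Proof.
move=> tile_t tR; pose F T := t |` T.
have [x xt] : exists x, x \in t.
  by have /is_tileP[x [y [_ ->]]] := tile_t; exists x; rewrite !inE eqxx.
have tnew T : T \in tilings (R `\` t) -> t \notin T.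
  case/tilingP=> _ _ cT; apply/negP => tT.
  have : x \in fcover T by apply/mem_fcover; exists t.
  by rewrite cT !inE xt.
have -> : [fset T in tilings R | t \in T] = [fset F T | T in tilings (R `\` t)].
  apply/fsetP=> T; rewrite in_fset inE /=; apply/andP/imfsetP => /=.
    case=> TR tT; exists (T `\ t); last by rewrite /F fsetD1K.
    have /tilingP[tiT trT cT] := TR; apply/tilingP; split.
    - by move=> u /fsetD1P[_ /tiT].
    - by move=> u v /fsetD1P[_ uT] /fsetD1P[_ vT]; apply: trT.
    apply/fsetP=> z; rewrite !inE -cT; apply/mem_fcover/andP.
      case=> u /fsetD1P[nut uT] zu; split; last by apply/mem_fcover; exists u.
      by apply: contra nut => zt; apply/eqP/(tiling_disjoint TR uT tT zu zt).
    case=> nzt /mem_fcover[u uT zu]; exists u; rewrite // !inE uT andbT.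
    by apply: contraNneq nzt => <-.
  case=> T' T'R ->; rewrite /F fset1U1; split=> //.
  have /tilingP[tiT trT cT] := T'R.
  have dis u : u \in T' -> [disjoint t & u].
    move=> uT; apply/fdisjointP => z zt; apply/negP => zu.
    have : z \in fcover T' by apply/mem_fcover; exists u.
    by rewrite cT !inE zt.
  apply/tilingP; split.
  - by move=> u /fset1UP[->|/tiT].
  - move=> u v /fset1UP[->|uT] /fset1UP[->|vT]; rewrite ?eqxx // => nuv.
    + exact: dis.
    + by rewrite fdisjoint_sym dis.
    exact: trT.
  apply/fsetP=> z; apply/mem_fcover/idP.
    case=> u /fset1UP[->|uT] zu; first exact: (fsubsetP tR).
    have : z \in fcover T' by apply/mem_fcover; exists u.
    by rewrite cT inE => /andP[].
  move=> zR; case: (boolP (z \in t)) => zt.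
    by exists t; rewrite // fset1U1.
  have : z \in fcover T' by rewrite cT !inE zt.
  by case/mem_fcover=> u uT zu; exists u; rewrite // !inE uT orbT.
rewrite card_in_imfset //= => T T' /tnew tT /tnew tT' FE.
by rewrite -(fsetU1K tT) -(fsetU1K tT') -/(F T) FE.
Qed.

(** Expansion along the cell [x]: exactly one tile of each tiling contains [x], so tilings are
    sorted by the partner of [x]. *)
Lemma M_deletion R x (nb : seq cell) : uniq nb -> x \in R ->
  (forall y, (y \in nb) = (y \in R) && share_edge x y) ->
  M R = \sum_(y <- nb) M (R `\` [fset x; y]).
Proof.
move=> nbU xR nbE.
have -> : \sum_(y <- nb) M (R `\` [fset x; y]) =
    \sum_(y <- nb) \sum_(T <- tilings R) (([fset x; y] \in T) : nat).
  rewrite !big_seq; apply: eq_bigr => y; rewrite nbE => /andP[yR xy].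
  rewrite -card_tilings_with.
  - by rewrite [RHS]big_mkcond /= -sum1_size -big_mkcond -big_fset_condE.
  - by apply/is_tileP; exists x, y.
  by apply/fsubsetP=> z /fset2P[]->.
rewrite exchange_big /= /M -sum1_size big_seq [RHS]big_seq.
apply: eq_bigr => T TR; have /tilingP[tiT trT cT] := TR.
have : x \in fcover T by rewrite cT.
case/mem_fcover=> t tT xt.
have [y [xy tE]] : exists y, share_edge x y /\ t = [fset x; y].
  have /is_tileP[u [v [uv tE]]] := tiT _ tT.
  move: xt; rewrite tE => /fset2P[]->; first by exists v.
  by exists u; rewrite share_edgeC fsetUC.
have yR : y \in R.
  by rewrite -cT; apply/mem_fcover; exists t; rewrite // tE !inE eqxx orbT.
have ynb : y \in nb by rewrite nbE yR.
rewrite (bigD1_seq y) //= -tE tT big_seq_cond big1 // => z /andP[znb nzy].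
apply/eqP; rewrite eqb0; apply/negP => zT.
have : [fset x; z] = [fset x; y].
  by rewrite -tE; apply: (tiling_disjoint TR zT tT _ xt); rewrite !inE eqxx.
move/fsetP/(_ z); rewrite !inE eqxx orbT (negPf nzy) orbF => /esym/eqP zx.
by move: znb; rewrite nbE zx /share_edge eqxx andbF.
Qed.

End Deletion.

(** * Transfer operators *)

Section BitSums.
Implicit Types (F G : bitseq -> nat) (n : nat).

Fixpoint bitsum n F : nat :=
  if n is n'.+1
  then bitsum n' (fun r => F (false :: r)) + bitsum n' (fun r => F (true :: r))
  else F [::].

Lemma eq_bitsum n F G :
  (forall r, size r = n -> F r = G r) -> bitsum n F = bitsum n G.
Proof.
elim: n F G => [|n IHn] F G FG /=; first exact: FG.
by congr (_ + _); apply: IHn => r rn; apply: FG; rewrite /= rn.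
Qed.

Lemma bitsum0 n : bitsum n (fun=> 0) = 0.
Proof. by elim: n => //= n ->. Qed.

Lemma bitsumD n F G :
  bitsum n (fun r => F r + G r) = bitsum n F + bitsum n G.
Proof. by elim: n F G => //= n IHn F G; rewrite !IHn addnACA. Qed.

Lemma bitsumZ n F m : bitsum n (fun r => m * F r) = m * bitsum n F.
Proof. by elim: n F => //= n IHn F; rewrite !IHn mulnDr. Qed.

Lemma bitsum_mul0 n F : bitsum n (fun r => 0 * F r) = 0.
Proof. by rewrite bitsumZ. Qed.

Lemma bitsum_muln0 n F : bitsum n (fun r => F r * 0) = 0.
Proof. by rewrite -[RHS](bitsum0 n); apply: eq_bitsum => r _; rewrite muln0. Qed.

Lemma bitsum_exchange n p (F : bitseq -> bitseq -> nat) :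
  bitsum n (fun r => bitsum p (F r)) = bitsum p (fun t => bitsum n (F^~ t)).
Proof.
by elim: n F => //= n IHn F; rewrite !IHn -bitsumD.
Qed.

Lemma bitsum_delta n F r0 : size r0 = n ->
  (forall r, size r = n -> r != r0 -> F r = 0) -> bitsum n F = F r0.
Proof.
elim: n F r0 => [|n IHn] F [|b r0] //= [r0n] F0.
have F0' c : c != b -> bitsum n (fun r => F (c :: r)) = 0.
  move=> ncb; rewrite (@eq_bitsum _ _ (fun=> 0)) ?bitsum0 // => r rn.
  by rewrite F0 /= ?rn // eqseq_cons (negPf ncb).
have Fb : bitsum n (fun r => F (b :: r)) = F (b :: r0).
  by apply: IHn => // r rn nr; rewrite F0 /= ?rn // eqseq_cons eqxx.
by case: b F0' Fb {F0} => F0' ->; rewrite F0' ?addn0.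
Qed.

End BitSums.

(* On the zigzag path r_0 - s_0 - r_1 - s_1 - ..., padded with unoccupied     *)
(* sites, tests whether the occupied sites have a perfect matching, when r_0  *)
(* has moreover to absorb an occupied site to its left if c holds.            *)
Fixpoint zigzag_match (c : bool) (s r : bitseq) : bool :=
  match s, r with
  | _, [::] => ~~ c && ~~ has id s
  | [::], b :: r' => (b == c) && ~~ has id r'
  | a :: s', b :: r' =>
      if c then b && zigzag_match a s' r'
      else if b then a && zigzag_match false s' r' else zigzag_match a s' r'
  end.

(** The carried site is one more site of the path, in front of [r_0]; reading from there exchanges
    the two rows. *)
Lemma zigzag_matchC c s r : zigzag_match c s r = zigzag_match false r (c :: s).
Proof.
elim: r c s => [|b r IHr] c s; first by case: s; case: c.
case: s => [|a s] /=; last first.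
  case: c => /=; first by rewrite IHr.
  case: b => /=; last by rewrite IHr.
  by rewrite IHr; case: r {IHr} => //=; case: a; case: s.
by case: c; case: b => //=; case: r {IHr}.
Qed.

(** Every edge of the path joins [r] to [s] or to the carried site. Hence [up] conserves particles
    and [down] conserves holes. *)
Lemma zigzag_match_count c s r :
  zigzag_match c s r -> count id r = c + count id s.
Proof.
elim: s c r => [|a s IHs] c [|b r] //=.
- by case: c.
- by rewrite has_count -leqNgt leqn0 => /andP[/eqP-> /eqP->].
- by case: c a => [] [] //=; rewrite has_count -leqNgt leqn0 => /eqP->.
case: c b => [] [] //=; first by move/IHs->; lia.
  by case/andP=> -> /IHs->; lia.
by move/IHs->; lia.
Qed.

(* Both act on the positions of the particles; the holes of down s are matched *)
(* with those of s, which is why its kernel takes complements.                *)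
Definition up (F : bitseq -> nat) (s : bitseq) : nat :=
  bitsum (size s).+1 (fun r => zigzag_match false s r * F r).

Definition down (F : bitseq -> nat) (s : bitseq) : nat :=
  if s is _ :: s' then
    bitsum (size s') (fun t =>
      zigzag_match false (map negb t) (map negb s) * F t)
  else 0.

Section UpDown.

(** The kernel of [up] followed by [down], generalized by carries: [c] for the matching of
    particles, [d] for that of holes. *)
Let updown c d (s t : bitseq) : nat :=
  bitsum (size s).+1 (fun r => zigzag_match c s r *
    zigzag_match d (map negb t) (map negb r)).

Let downup c d (s t : bitseq) : nat :=
  bitsum (size s).-1 (fun r => zigzag_match c (map negb r) (map negb s) *
    zigzag_match d r t).

(* The common shape of the kernels of up o down and down o up, obtained by    *)
(* scanning s and t: the positions where they differ alternate between        *)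
(* belonging to s only and to t only, and b tells that the next of them must   *)
(* belong to t only.                                                          *)
Fixpoint alternations (b : bool) (s t : bitseq) : nat :=
  match s, t with
  | x :: s', y :: t' =>
      if x == y then alternations b s' t'
      else if b == x then 0 else (if b then 2 else 1) * alternations (~~ b) s' t'
  | _, _ => b
  end.

(** Without carry, a position where [s] and [t] agree forces the bit of [r]; a position in [s] only
    leaves it free, each value opening one of the two carries, whence the 2. With one carry the bit
    is forced, and a position in [t] only closes the carry. Both carries would make a site occupied
    and empty. *)
Let updownE s t : size s = size t ->
  [/\ updown false false s t = 2 * alternations false s t,
      updown true false s t = alternations true s t,
      updown false true s t = alternations true s t
    & updown true true s t = 0].
Proof.
rewrite /updown; elim: s t => [|a s IHs] [|b t] //= [/IHs{IHs}].
move=> /= [e1 e2 e3 e4]; split; case: a; case: b => /=;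
  rewrite ?(bitsum_mul0, bitsum_muln0) ?(e1, e2, e3, e4); lia.
Qed.

(** Again a position in [s] only leaves the intermediate bit free, and its value decides which carry
    opens; the recursion only closes on the sum of the two carried kernels. *)
Let downupE s t : size s = size t -> 0 < size s ->
  downup false false s t = alternations false s t /\
  downup true false s t + downup false true s t = alternations true s t.
Proof.
rewrite /downup; elim: s t => [|a s IHs] [|b t] //= [st] _.
(* The intermediate row is one shorter, so the recursion starts at length one. *)
case: s st IHs => [|a' s] /= st IHs.
  by case: t st => // _; case: a b => [] [].
case: t st => [|b' t] //= st.
have [//|//|/= e1 e2] := IHs (b' :: t).
by case: a; case: b => /=; split; 
  rewrite ?(bitsum_mul0, bitsum_muln0); lia.
Qed.

(** Exchanging the summations gives both sides a kernel between rows of equal length: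
    [2 * alternations false] and [alternations false]. *)
Lemma up_down F s : up (down F) s = 2 * down (up F) s.
Proof.
case: s => [|a s]; first by rewrite /up /= !muln0.
set sz := size (a :: s).
have -> : up (down F) (a :: s) =
    bitsum sz (fun t => updown false false (a :: s) t * F t).
  rewrite /up (@eq_bitsum _ _ (fun r => bitsum sz (fun t =>
    zigzag_match false (a :: s) r *
    zigzag_match false (map negb t) (map negb r) * F t))) => [|r].
    rewrite bitsum_exchange; apply: eq_bitsum => t _; rewrite /updown.
    rewrite mulnC -bitsumZ; apply: eq_bitsum => r _; lia.
  case: r => // c r [rs]; rewrite /down rs -bitsumZ.
  by apply: eq_bitsum => t _; rewrite mulnA.
have -> : down (up F) (a :: s) =
    bitsum sz (fun t => downup false false (a :: s) t * F t).
  rewrite /down (@eq_bitsum _ _ (fun r => bitsum sz (fun t =>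
    zigzag_match false (map negb r) (map negb (a :: s)) *
    zigzag_match false r t * F t))) => [|r rs].
    rewrite bitsum_exchange; apply: eq_bitsum => t _; rewrite /downup.
    rewrite mulnC -bitsumZ; apply: eq_bitsum => r _; lia.
  rewrite /up rs -bitsumZ.
  by apply: eq_bitsum => t _; rewrite mulnA.
rewrite -bitsumZ; apply: eq_bitsum => t ts.
have [-> _ _ _] := updownE (esym ts).
by have [//|-> _] := downupE (esym ts); rewrite mulnA.
Qed.

End UpDown.

Lemma eq_up F G : F =1 G -> up F =1 up G.
Proof. by move=> FG s; apply: eq_bitsum => r _; rewrite FG. Qed.

Lemma eq_down F G : F =1 G -> down F =1 down G.
Proof. by move=> FG [|a s] //; apply: eq_bitsum => r _; rewrite FG. Qed.

Lemma upZ m F s : up (fun r => m * F r) s = m * up F s.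
Proof. by rewrite -bitsumZ; apply: eq_bitsum => r _; rewrite mulnCA. Qed.

Lemma downZ m F s : down (fun r => m * F r) s = m * down F s.
Proof.
case: s => [|a s]; first by rewrite muln0.
by rewrite -bitsumZ; apply: eq_bitsum => r _; rewrite mulnCA.
Qed.

(** * Sorting words in [up] and [down] *)

Definition transfer (ops : bitseq) (F : bitseq -> nat) : bitseq -> nat :=
  foldr (fun u G => if u then up G else down G) F ops.

Fixpoint inversions (ops : bitseq) : nat :=
  if ops is u :: ops' then u * count negb ops' + inversions ops' else 0.

Lemma up_iter_down q F s :
  up (iter q down F) s = 2 ^ q * iter q down (up F) s.
Proof.
elim: q s => [|q IHq] s; first by rewrite mul1n.
by rewrite /= up_down (eq_down IHq) downZ expnS mulnA.
Qed.

(** Each exchange of an [up] with a later [down] yields a factor 2, and sorting takes one exchange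
    per inversion. *)
Lemma transferE ops F s : transfer ops F s =
  2 ^ inversions ops * iter (count negb ops) down (iter (count id ops) up F) s.
Proof.
elim: ops s => [|u ops IHops] s /=; first by rewrite mul1n.
case: u => /=; last by rewrite (eq_down IHops) downZ.
by rewrite (eq_up IHops) upZ up_iter_down mul1n expnD [2 ^ _ * 2 ^ _]mulnC mulnA.
Qed.

Lemma zigzag_match_empty n : zigzag_match false (nseq n false) (nseq n.+1 false).
Proof. by elim: n. Qed.

Lemma zigzag_match_none n r : zigzag_match false (nseq n false) r -> ~~ has id r.
Proof. by move/zigzag_match_count; rewrite count_nseq has_count => ->. Qed.

Lemma not_hasE (r : bitseq) : ~~ has id r -> r = nseq (size r) false.
Proof. by elim: r => [|[] r IHr] //= /IHr{1}->. Qed.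

Lemma up_empty F n : up F (nseq n false) = F (nseq n.+1 false).
Proof.
rewrite /up size_nseq (@bitsum_delta _ _ (nseq n.+1 false)) ?size_nseq //.
  by rewrite zigzag_match_empty mul1n.
move=> r rn nr; case: (boolP (zigzag_match _ _ _)) => // /zigzag_match_none.
by move/not_hasE => rE; rewrite rE rn eqxx in nr.
Qed.

(** [down] conserves holes, so a full row can only be followed by a full row. *)
Lemma down_full F n : down F (nseq n.+1 true) = F (nseq n true).
Proof.
rewrite -[nseq n.+1 true]/(true :: nseq n true) /down size_nseq.
rewrite (@bitsum_delta _ _ (nseq n true)) ?size_nseq //.
  have -> : map negb (true :: nseq n true) = nseq n.+1 false.
    by rewrite /= map_nseq.
  by rewrite map_nseq zigzag_match_empty mul1n.
move=> r rn nr; case: (boolP (zigzag_match _ _ _)) => // /zigzag_match_count.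
rewrite /= map_nseq !add0n count_map count_nseq mul0n => /esym/eqP.
rewrite -leqn0 leqNgt -has_count => /hasPn hr; case/eqP: nr.
apply: (@eq_from_nth _ false); rewrite ?size_nseq // rn => i ri.
by rewrite nth_nseq ri -[nth _ _ _]negbK -/(nth _ _ _) hr // mem_nth // rn.
Qed.

Lemma iter_up_empty p s : iter p up (fun r => ~~ has id r : nat) s = ~~ has id s.
Proof.
elim: p s => // p IHp s; rewrite iterS (eq_up IHp); have [|hs] := boolP (has id s).
  move=> hs; rewrite /up -[RHS](bitsum0 (size s).+1).
  apply: eq_bitsum => r _; case: (boolP (zigzag_match _ _ _)) => //.
  by move/zigzag_match_count; rewrite !has_count in hs * => ->; rewrite hs.
by rewrite (not_hasE hs) up_empty has_nseq andbF.
Qed.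

(** [up] conserves particles but lengthens the row, so it never reaches a full row. *)
Lemma iter_up_full p s : iter p.+1 up (fun r => all id r : nat) s = 0.
Proof.
elim: p s => [|p IHp] s; last first.
  by rewrite iterS (eq_up IHp) -[RHS](bitsum0 (size s).+1); apply: eq_bitsum => r _;
     rewrite muln0.
rewrite /= /up -[RHS](bitsum0 (size s).+1); apply: eq_bitsum => r rn.
case: (boolP (zigzag_match _ _ _)) => // /zigzag_match_count; rewrite add0n.
rewrite all_count rn => ->; rewrite eqn_leq [_.+1 <= _]ltnNge count_size andbF //.
Qed.

Lemma iter_down0 q s : iter q down (fun=> 0) s = 0.
Proof.
elim: q s => //= q IHq [|a s] //; rewrite (eq_down IHq) /down.
exact: bitsum_muln0.
Qed.

Lemma iter_down_full q F n :
  iter q down F (nseq n true) = (q <= n) * F (nseq (n - q) true).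
Proof.
elim: q F n => [|q IHq] F n; first by rewrite subn0 mul1n.
rewrite iterSr IHq; case: (ltngtP q n) => [qn|//|->]; last first.
  by rewrite subnn muln0.
by rewrite -[n - q]prednK ?subn_gt0 // down_full -subnS.
Qed.

(** After sorting, [q] down steps shorten the full row to length [n - q], and the up steps conserve
    its particles; ending empty forces [q = n]. *)
Lemma transfer_empty ops n :
  transfer ops (fun r => ~~ has id r : nat) (nseq n true) =
  (count negb ops == n) * 2 ^ inversions ops.
Proof.
rewrite transferE iter_down_full iter_up_empty has_nseq andbT -leqNgt leqn0.
by rewrite subn_eq0 mulnC; case: ltngtP; rewrite ?mul0n.
Qed.

Lemma transfer_full ops s : has id ops ->
  transfer ops (fun r => all id r : nat) s = 0.
Proof.
rewrite has_count transferE => /prednK <-.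
set G := iter _ up _; have G0 : G =1 fun=> 0 by move=> r; apply: iter_up_full.
have -> : forall q, iter q down G s = 0; last by rewrite muln0.
move=> q; rewrite -[RHS](iter_down0 q s).
by elim: q s => [|q IHq] s /=; [apply: G0 | apply: eq_down].
Qed.

(** * Matching one row into the next *)

Section Scan.
Implicit Types (s xs ys zs nb : seq cell) (b : bitseq).

Definition Mseq s : nat := M [fset z in s]%fset.

Lemma in_seq_fset (T : choiceType) (s : seq T) x : (x \in [fset z in s]%fset) = (x \in s).
Proof. by rewrite in_fset. Qed.

Lemma eq_Mseq s s' : s =i s' -> Mseq s = Mseq s'.
Proof.
by move=> ss'; congr M; apply/fsetP=> z; rewrite !in_seq_fset.
Qed.

Lemma Mseq_nil : Mseq [::] = 1.
Proof.
rewrite /Mseq -[RHS]M0; congr M; apply/fsetP=> z; by rewrite in_seq_fset inE.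
Qed.

Lemma Mseq_cons x s nb : x \notin s -> uniq nb ->
  (forall y, (y \in nb) = (y \in s) && share_edge x y) ->
  Mseq (x :: s) = \sum_(y <- nb) Mseq (filter (predC1 y) s).
Proof.
move=> xs nbU nbE; rewrite /Mseq (@M_deletion _ x nb) //.
- apply: eq_bigr => y _; congr M; apply/fsetP=> z.
  rewrite in_fsetD !in_seq_fset mem_filter !inE negb_or /=.
  by case: (eqVneq z x) => [->|] /=; rewrite ?(negPf xs) ?andbF.
- by rewrite in_seq_fset mem_head.
move=> y; rewrite nbE in_seq_fset inE; case: eqP => // ->.
by rewrite /share_edge eqxx andbF.
Qed.

(* Eliminates the cells of xs from left to right; c records that the first    *)
(* cell of ys has already been matched.  When ys is as long as xs, the last    *)
(* cell of xs has a single neighbour.                                         *)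
Lemma Mseq_zigzag (d : cell) b xs ys zs c :
  size b = size xs -> size ys = size xs \/ size ys = (size xs).+1 ->
  c ==> (ys != [::]) -> uniq (xs ++ ys ++ zs) ->
  (forall i z, i < size xs -> z \in xs ++ ys ++ zs ->
    share_edge (nth d xs i) z =
    (z == nth d ys i) || (i.+1 < size ys) && (z == nth d ys i.+1)) ->
  Mseq (mask b xs ++ drop c ys ++ zs) =
  bitsum (size ys) (fun r =>
    zigzag_match c b r * Mseq (mask (map negb r) ys ++ zs)).
Proof.
elim: b xs ys zs c => [|a b IHb] [|x xs] ys zs c //=.
  move=> _ [/size0nil->|]; first by case: c => //= _ _ _; rewrite mul1n.
  case: ys => [|y []] //= _ _ _ _; case: c => /=.
    by rewrite mul0n mul1n.
  by rewrite mul1n mul0n addn0.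
move=> [bx]; case: ys => [|y ys] /= sz; first by case: sz.
have {}sz : size ys = size xs \/ size ys = (size xs).+1.
  by case: sz => [][]; [left|right].
move=> _ U adj.
have U1 : uniq (xs ++ ys ++ zs).
  apply: (subseq_uniq _ (andP U).2).
  by rewrite cat_subseq // subseq_cons.
have U2 : uniq (xs ++ ys ++ y :: zs).
  have := (andP U).2; congr is_true; apply: perm_uniq.
  by rewrite perm_cat2l -[ys ++ y :: zs]cat_rcons -cat_cons perm_cat2r perm_sym perm_rcons.
have adj1 i z : i < size xs -> z \in xs ++ ys ++ y :: zs ->
    share_edge (nth d xs i) z =
    (z == nth d ys i) || (i.+1 < size ys) && (z == nth d ys i.+1).
  move=> ix; rewrite !(mem_cat, inE) => zin.
  rewrite (adj i.+1) // inE !(mem_cat, inE) orbC.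
  by case/or4P: zin => -> ; rewrite ?orbT.
have adj2 i z : i < size xs -> z \in xs ++ ys ++ zs ->
    share_edge (nth d xs i) z =
    (z == nth d ys i) || (i.+1 < size ys) && (z == nth d ys i.+1).
  move=> ix zin; apply: adj1 => //; move: zin; rewrite !(mem_cat, inE).
  by case/or3P=> ->; rewrite ?orbT.
(* Once [x] is treated, [y] is either used up ([IH2]) or out of reach of the remaining cells of
   [xs], and then joins [zs] ([IH1]). *)
have IH1 c' : c' ==> (ys != [::]) ->
    Mseq (mask b xs ++ drop c' ys ++ y :: zs) =
    bitsum (size ys) (fun r =>
    zigzag_match c' b r * Mseq (y :: mask (map negb r) ys ++ zs)).
  move=> c'ys; rewrite IHb //; apply: eq_bitsum => r _; congr (_ * _).
  by apply: eq_Mseq => z; rewrite !(mem_cat, inE) orbCA.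
have IH2 c' : c' ==> (ys != [::]) ->
    Mseq (mask b xs ++ drop c' ys ++ zs) =
    bitsum (size ys) (fun r =>
    zigzag_match c' b r * Mseq (mask (map negb r) ys ++ zs)).
  by move=> c'ys; rewrite IHb.
have /andP[xN U'] := U.
have xNb : x \notin mask b xs ++ drop c (y :: ys) ++ zs.
  apply: contra xN; rewrite -cat_cons !mem_cat => /or3P[/mem_mask->|/mem_drop->|->] //;
  by rewrite ?orbT.
have adjx z : z \in xs ++ (y :: ys) ++ zs ->
    share_edge x z = (z == y) || (0 < size ys) && (z == nth d ys 0).
  by move=> zin; rewrite (adj 0) // inE zin orbT.
have yN : [/\ y \notin xs, y \notin ys & y \notin zs].
  move: U'; rewrite cat_uniq /= => /and3P[_ ].
  rewrite negb_or => /andP[yx _].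
  by rewrite mem_cat negb_or => /andP[/andP[-> ->] _].
have y'N : 0 < size ys ->
    [/\ nth d ys 0 \notin xs, nth d ys 0 \notin behead ys
      & nth d ys 0 \notin zs].
  case: (ys) U1 => //= y' ys' U1' _.
  move: U1'; rewrite cat_uniq /= => /and3P[_ ].
  rewrite negb_or => /andP[yx _].
  by rewrite mem_cat negb_or => /andP[/andP[-> ->] _].
case: a => /=; last first.
  case: c {adj xNb} => /=.
    rewrite bitsum_mul0 add0n -IH2 // drop0 //.
  rewrite bitsum_mul0 addn0 -IH1 //; apply: eq_Mseq => z.
  by rewrite drop0 !(mem_cat, inE); case: (z \in mask _ _); case: (z == y); rewrite ?orbT.
(* A second neighbour of [x] is missing only if [x] is the last cell and the rows are equally
   long. *)
have ys_case : (0 < size ys) \/ (ys = [::] /\ b = [::]).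
  case: (ys) sz => [|y' ys'] /=; last by left.
  by case=> // /esym/size0nil xs0; right; split=> //; apply: size0nil; rewrite bx xs0.
have nbE z : z \in mask b xs ++ drop c (y :: ys) ++ zs ->
    share_edge x z = (z == y) || (0 < size ys) && (z == nth d ys 0).
  move=> zin; apply: adjx; move: zin; rewrite !mem_cat.
  by case/or3P=> [/mem_mask->|/mem_drop->|->]; rewrite ?orbT.
have y_match : Mseq (filter (predC1 y) (mask b xs ++ drop c (y :: ys) ++ zs)) =
    Mseq (mask b xs ++ ys ++ zs).
  apply: eq_Mseq => z; rewrite mem_filter /= !mem_cat.
  have [->|zy] := eqVneq z y; case: yN => yx yy yz.
    by rewrite (negPf yy) (negPf yz) (contraNF (@mem_mask _ _ _ _) yx).
  by case: (c); rewrite /= ?drop0 // inE (negPf zy).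
have y'_match : 0 < size ys ->
    Mseq (filter (predC1 (nth d ys 0)) (mask b xs ++ drop c (y :: ys) ++ zs)) =
    Mseq (mask b xs ++ drop 1 ys ++ if c then zs else y :: zs).
  move=> ys0; have := y'N ys0; case: (ys) ys0 yN => //= y' ys' _ [_ yys' _].
  case=> y'x y'y y'z.
  apply: eq_Mseq => z; rewrite mem_filter /= !mem_cat drop0.
  have [->|zy] := eqVneq z y'.
    rewrite (negPf y'y) (contraNF (@mem_mask _ _ _ _) y'x).
    case: (c) => /=; first by rewrite (negPf y'z).
    rewrite inE (negPf y'z) orbF; apply/esym/negbTE.
    by apply: contraNneq yys' => <-; rewrite inE eqxx.
  case: (c) => /=; rewrite ?drop0 !inE (negPf zy) //=.
  by case: (z \in mask _ _); case: (z == y); rewrite ?orbT.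
(* Expand along [x]: its partner is [y], unless [y] is already matched, or the next cell of the row,
   if any. *)
rewrite (@Mseq_cons x _ ([seq z <- [:: y] | ~~ c] ++ take 1 ys)) //.
- rewrite big_cat; case: c y_match y'_match {adj xNb nbE} => /= y_m y'_m.
    rewrite big_nil add0n bitsum_mul0 add0n.
    case: ys_case => [ys0|[-> ->]]; last by rewrite big_nil.
    rewrite -IH2 ?ys0 //; last by rewrite -size_eq0 -lt0n.
    case: (ys) ys0 y'_m => //= y' ys' _ y'_m.
    by rewrite take0 big_seq1 y'_m.
  rewrite big_seq1 y_m addnC -IH2 // drop0; congr (_ + _).
  case: ys_case => [ys0|[-> ->]]; last by rewrite big_nil.
  rewrite -IH1 ?ys0 //; last by rewrite -size_eq0 -lt0n.
  case: (ys) ys0 y'_m => //= y' ys' _ y'_m.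
  by rewrite take0 big_seq1 y'_m.
- case: yN => _ yy _; case: (ys) yy => [|y' ys'] /=; first by case: (c).
  by rewrite inE negb_or => /andP[yy' _]; case: (c); rewrite /= take0 //= inE yy'.
move=> z; rewrite mem_cat mem_filter inE.
have -> : (z \in take 1 ys) = (0 < size ys) && (z == nth d ys 0).
  by case: (ys) => //= y' ys'; rewrite take0 inE.
have [zin|zin] := boolP (z \in mask b xs ++ drop c (y :: ys) ++ zs) => /=.
  rewrite nbE //; congr (_ || _); case: eqP => //= [zy|]; last by rewrite andbF.
  rewrite andbT; case: (c) zin => //=.
  rewrite zy !mem_cat; case: yN => yx yy yz.
  by rewrite drop0 (negPf yy) (negPf yz) (contraNF (@mem_mask _ _ _ _) yx).
apply: contraNF zin => /orP[/andP[cN /eqP->]|/andP[ys0 /eqP->]].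
  by rewrite !mem_cat (negPf cN) /= inE eqxx orbT.
by case: (ys) ys0 => //= y' ys' _; rewrite !mem_cat; case: (c);
   rewrite /= !inE ?drop0 eqxx ?orbT.
Qed.
End Scan.

(** * Strips of rows *)

Local Open Scope ring_scope.

Lemma share_edgeE (s t : Defs.shape) (p q : point) : share_edge (s, p) (t, q) =
  [|| [&& s != Up, t != Dn & (q == south_of p) || (q == east_of p)],
      [&& t != Up, s != Dn & (p == south_of q) || (p == east_of q)]
    | (p == q) && (s != t)].
Proof.
(* Coincidences of edges depend only on the displacement [(a, b)]; once compared with 0, 1 and -1
   they leave a finite Boolean check. *)
case: p q => [i j] [k l]; pose a := k - i; pose b := l - j.
have xE : ((i == k) = (a == 0)) * ((k == i) = (a == 0)) *
    ((i + 1 == k + 1) = (a == 0)) * ((k + 1 == i + 1) = (a == 0)) *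
    ((i + 1 == k) = (a == 1)) * ((k == i + 1) = (a == 1)) *
    ((i == k + 1) = (a == -1)) * ((k + 1 == i) = (a == -1)).
  by rewrite /a; do !split; lia.
have yE : ((j == l) = (b == 0)) * ((l == j) = (b == 0)) *
    ((j + 1 == l + 1) = (b == 0)) * ((l + 1 == j + 1) = (b == 0)) *
    ((j + 1 == l) = (b == 1)) * ((l == j + 1) = (b == 1)) *
    ((j == l - 1) = (b == 1)) * ((l == j - 1) = (b == -1)) *
    ((j == l + 1) = (b == -1)) * ((l + 1 == j) = (b == -1)).
  by rewrite /b; do !split; lia.
have excl (c : int) :
    [&& ~~ ((c == 0) && (c == 1)), ~~ ((c == 0) && (c == -1))
      & ~~ ((c == 1) && (c == -1))] by lia.
have := excl a; have := excl b; rewrite /share_edge /south_of /east_of /=.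
case: s; case: t; rewrite /= ?inE !xpair_eqE /= ?(xE, yE) /=;
move: (a == 0) (a == 1) (a == -1) (b == 0) (b == 1) (b == -1);
by do 6!case.
Qed.

Lemma bitsum_negb n F : bitsum n F = bitsum n (fun r => F (map negb r)).
Proof.
elim: n F => //= n IHn F; rewrite addnC; congr (_ + _)%N; exact: IHn.
Qed.

Lemma Mseq_isolated x s : x \notin s -> (forall z, z \in s -> ~~ share_edge x z) ->
  Mseq (x :: s) = 0%N.
Proof.
move=> xs adj; rewrite (@Mseq_cons x s [::]) ?big_nil // => z.
by case: (boolP (z \in s)) => //= /adj /negPf->.
Qed.

(** For crossing a drawn diagonal: each remaining triangle has only its mirror image as neighbour,
    so its partner is forced. *)
Lemma Mseq_parallel (d : cell) (b : bitseq) (xs ys zs : seq cell) :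
  size b = size xs -> size ys = size xs -> uniq (xs ++ ys ++ zs) ->
  (forall i z, (i < size xs)%N -> z \in xs ++ ys ++ zs ->
    share_edge (nth d xs i) z = (z == nth d ys i)) ->
  Mseq (mask b xs ++ ys ++ zs) = Mseq (mask (map negb b) ys ++ zs).
Proof.
elim: b xs ys zs => [|a b IHb] [|x xs] [|y ys] zs //= [bx] [yx] U adj.
have U2 : uniq (xs ++ ys ++ y :: zs).
  have := (andP U).2; congr is_true; apply: perm_uniq.
  by rewrite perm_cat2l -[ys ++ y :: zs]cat_rcons -cat_cons perm_cat2r perm_sym
             perm_rcons.
have U1 : uniq (xs ++ ys ++ zs).
  apply: (subseq_uniq _ (andP U).2).
  by rewrite cat_subseq // subseq_cons.
have adj1 i z : (i < size xs)%N -> z \in xs ++ ys ++ y :: zs ->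
    share_edge (nth d xs i) z = (z == nth d ys i).
  move=> ix; rewrite !(mem_cat, inE) => zin.
  rewrite (adj i.+1) // inE !(mem_cat, inE) orbC.
  by case/or4P: zin => -> ; rewrite ?orbT.
have adj2 i z : (i < size xs)%N -> z \in xs ++ ys ++ zs ->
    share_edge (nth d xs i) z = (z == nth d ys i).
  move=> ix zin; apply: adj1 => //; move: zin; rewrite !(mem_cat, inE).
  by case/or3P=> ->; rewrite ?orbT.
case: a => /=; last first.
  rewrite -[RHS](@eq_Mseq (mask (map negb b) ys ++ y :: zs)); last first.
    by move=> z; rewrite !(mem_cat, inE) orbCA.
  rewrite -(IHb xs) //; apply: eq_Mseq => z; rewrite !(mem_cat, inE).
  by case: (z \in mask _ _); case: (z == y); rewrite ?orbT.
have /andP[xN U'] := U.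
have sub z : z \in mask b xs ++ y :: ys ++ zs -> z \in xs ++ y :: ys ++ zs.
  by rewrite !(mem_cat, inE) => /or4P[/mem_mask->|->|->|->]; rewrite ?orbT.
rewrite (@Mseq_cons x _ [:: y]) //.
- rewrite big_seq1 -(IHb xs) //; apply: eq_Mseq => z.
  rewrite mem_filter /= !(mem_cat, inE); have [->|//] := eqVneq z y.
  move: U'; rewrite cat_uniq /= negb_or mem_cat negb_or.
  case/and3P=> _ /andP[yx' _] /andP[/andP[/negPf-> /negPf->] _].
  by rewrite (contraNF (@mem_mask _ _ _ _) yx').
- by apply: contra xN; apply: sub.
move=> z; rewrite inE; case: (boolP (z \in _)) => /= [/sub zin|zin].
  by rewrite (adj 0%N) // inE zin orbT.
by apply: contraNF zin => /eqP->; rewrite mem_cat inE eqxx orbT.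
Qed.

(* A row of cells is given by its leftmost cell and its width. *)
Definition cell_row := (cell * nat)%type.
Definition shift (p : point) (k : nat) : point := (p.1 + k%:Z, p.2 + k%:Z).
Definition row_cells (r : cell_row) : seq cell :=
  [seq (r.1.1, shift r.1.2 k) | k <- iota 0 r.2].

(* The order of the rows of a strip: the up-pointing triangles on a diagonal  *)
(* come before the down-pointing ones.                                        *)
Definition below (x y : cell) : bool :=
  (cdiag y < cdiag x) || [&& cdiag y == cdiag x, x.1 == Up & y.1 == Dn].

(** Away from drawn diagonals, a row gains or loses half a cell at each end, according to its
    colour. *)
Definition next_row (bl : pred cell) : rel cell_row := fun r r' =>
  (bl r'.1 == ~~ bl r.1) &&
  if r'.1.1 == Dn then [&& r.1.1 == Up, r'.1.2 == r.1.2 & r'.2 == r.2]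
  else (r.1.1 != Up) &&
    if bl r.1 then (r'.1.2 == east_of r.1.2) && (r'.2.+1 == r.2)
    else (r'.1.2 == south_of r.1.2) && (r'.2 == r.2.+1).

Lemma size_row_cells r : size (row_cells r) = r.2.
Proof. by rewrite size_map size_iota. Qed.

Lemma nth_row_cells d r k : (k < r.2)%N ->
  nth d (row_cells r) k = (r.1.1, shift r.1.2 k).
Proof. by move=> kr; rewrite (nth_map 0%N) ?size_iota // nth_iota. Qed.

Lemma row_cellsP r z :
  reflect (exists2 k, (k < r.2)%N & z = (r.1.1, shift r.1.2 k))
          (z \in row_cells r).
Proof.
apply: (iffP mapP) => [[k]|[k kr ->]]; rewrite ?mem_iota.
  by exists k.
by exists k; rewrite // mem_iota.
Qed.

Lemma mem_row_cells r z : z \in row_cells r ->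
  z.1 = r.1.1 /\ cdiag z = cdiag r.1.
Proof.
case: r => [[s [i j]] w] /row_cellsP[k _ ->]; split=> //.
by rewrite /cdiag /diag /shift /=; lia.
Qed.

Lemma uniq_row_cells r : uniq (row_cells r).
Proof.
rewrite map_inj_uniq ?iota_uniq // => k l [] /= h _; lia.
Qed.

Lemma below_trans : transitive below.
Proof.
move=> y x z; rewrite /below.
case: (x.1) => /=; case: (y.1) => /=; case: (z.1) => /=; rewrite ?andbF ?andbT ?orbF; lia.
Qed.

Lemma next_row_below bl r r' : next_row bl r r' -> below r.1 r'.1.
Proof.
case: r r' => [[s p] w] [[t q] w'] /andP[_] /=; rewrite /below /cdiag /=.
have step : (s != Up) && (if bl (s, p) then (q == east_of p) && (w'.+1 == w)
    else (q == south_of p) && (w' == w.+1)) -> diag q < diag p.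
  by case/andP=> _; case: (bl _) => /andP[/eqP-> _]; case: (p) => i j;
     rewrite /diag /south_of /east_of /=; lia.
case: t => /= [/step->|/step->|] //.
by case/and3P=> -> /eqP-> _; rewrite eqxx orbT.
Qed.

Definition strip_cells (rs : seq cell_row) : seq cell := flatten (map row_cells rs).

Lemma path_below bl r rs : path (next_row bl) r rs ->
  {in rs, forall r', below r.1 r'.1}.
Proof.
move=> pr; have : path (relpre fst below) r rs.
  by apply: sub_path pr => r1 r2; apply: next_row_below.
rewrite path_sortedE; last by move=> r1 r2 r3; apply: below_trans.
by case/andP=> /allP.
Qed.

Lemma strip_below bl r rs z : path (next_row bl) r rs ->
  z \in strip_cells rs -> below r.1 z.
Proof.
move/path_below=> bel /flatten_mapP[r' r'in /mem_row_cells[zs zd]].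
by have := bel _ r'in; rewrite /below zs zd.
Qed.

Lemma uniq_strip bl r rs : path (next_row bl) r rs -> uniq (strip_cells (r :: rs)).
Proof.
elim: rs r => [|r' rs IHrs] r /=; first by rewrite /strip_cells /= cats0 uniq_row_cells.
move=> pr; have := pr; case/andP=> rr' pr'.
rewrite /strip_cells map_cons /= cat_uniq uniq_row_cells IHrs // andbT /=.
apply/hasPn => z zin; apply/negP => /mem_row_cells[zs zd].
have := @strip_below _ _ (r' :: rs) z pr zin; rewrite /below zs zd eqxx ltxx /=.
by case: (r.1.1).
Qed.

Lemma row_isolated r z k : z \in row_cells r ->
  ~~ share_edge (r.1.1, shift r.1.2 k) z.
Proof.
case: z => t q /mem_row_cells[/= -> qd]; rewrite share_edgeE eqxx andbF orbF.
rewrite /cdiag /diag /= in qd.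
case: r qd => [[s [i j]] w] /=; case: q => [u v] /= qd.
by rewrite /south_of /east_of /shift /= !xpair_eqE; case: s; rewrite /=; lia.
Qed.

(** Neighbours lie in adjacent rows; with the rows above exhausted, only two candidates in the next
    row are left. *)
Lemma share_edge_step s s' p z : s != Up -> s' != Dn ->
  (z.1 = s /\ cdiag z = diag p) \/
  (z.1 = s' /\ cdiag z = diag p - 1) \/ below (s', south_of p) z ->
  share_edge (s, p) z = (z == (s', south_of p)) || (z == (s', east_of p)).
Proof.
case: z p => t [u v] [i j] sUp s'Dn; rewrite share_edgeE /below /cdiag /diag.
rewrite /south_of /east_of /= !xpair_eqE /=.
case=> [[tE]|[[tE]|]]; try subst t; move: sUp s'Dn.
- by case: s s' => [] [] //= _ _; lia.
- by case: s s' => [] [] //= _ _; lia.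
by case: s s' t => [] [] [] //= _ _; rewrite -?[Sq == Dn]/false -?[Up == Dn]/false; lia.
Qed.

Lemma share_edge_base p z :
  (z.1 = Up /\ cdiag z = diag p) \/
  (z.1 = Dn /\ cdiag z = diag p) \/ below (Dn, p) z ->
  share_edge (Up, p) z = (z == (Dn, p)).
Proof.
case: z p => t [u v] [i j]; rewrite share_edgeE /below /cdiag /diag.
rewrite /south_of /east_of /= !xpair_eqE /=.
case=> [[->]|[[->]|]] /=; [lia|lia|].
by case: t => //=; lia.
Qed.

Lemma south_shift p k : south_of (shift p k) = shift (south_of p) k.
Proof. by rewrite /south_of /shift /=; congr (_, _); lia. Qed.

Lemma east_shift p k : east_of (shift p k) = shift (east_of p) k.
Proof. by rewrite /east_of /shift /=; congr (_, _); lia. Qed.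

Lemma south_shiftS p k : south_of (shift p k.+1) = shift (east_of p) k.
Proof. by rewrite /south_of /east_of /shift /=; congr (_, _); lia. Qed.

Lemma east_shiftE p k : east_of (shift p k) = shift (south_of p) k.+1.
Proof. by rewrite /south_of /east_of /shift /=; congr (_, _); lia. Qed.

Lemma diag_east_south p : diag (east_of p) = diag (south_of p).
Proof. by rewrite /diag /=; lia. Qed.

Lemma diag_shift p k : diag (shift p k) = diag p.
Proof. by rewrite /diag /shift /=; lia. Qed.

Lemma shift_inj p : injective (shift p).
Proof. by move=> k l [] h _; lia. Qed.

(** Entering a black row is an up step, entering a white one a down step; rows entered across a
    drawn diagonal leave no letter. *)
Definition ops (bl : pred cell) (rs : seq cell_row) : bitseq :=
  [seq bl r.1 | r <- rs & r.1.1 != Dn].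

(** The final condition: below the last row nothing can be matched, so particles fill it if it is
    black and are absent if it is white. *)
Definition all_matched (b : bool) (s : bitseq) : nat :=
  if b then all id s else ~~ has id s.

Section Strip.
Variables (d : cell) (bl : pred cell).

Lemma Mseq_last_row (r : cell_row) (b : bitseq) : size b = r.2 ->
  Mseq (mask b (row_cells r)) = ~~ has id b :> nat.
Proof.
move=> br; case: (boolP (has id b)) => /= [hb|nb]; last first.
  rewrite (_ : mask _ _ = [::]) ?Mseq_nil //; apply: size0nil.
  rewrite size_mask ?size_row_cells //.
  by rewrite has_count -leqNgt leqn0 in nb; apply/eqP.
have : size (mask b (row_cells r)) = count id b.
  by rewrite size_mask ?size_row_cells.
have := mask_uniq (uniq_row_cells r) b.
have sub : {subset mask b (row_cells r) <= row_cells r} by move=> z /mem_mask.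
case: (mask _ _) sub => [|x s] sub /= U sz.
  by move: hb; rewrite has_count -sz.
have /row_cellsP[k _ xE] : x \in row_cells r by apply: sub; rewrite mem_head.
apply: Mseq_isolated => [|z zs]; first by case/andP: U.
by rewrite xE; apply: row_isolated; apply: sub; rewrite inE zs orbT.
Qed.

Lemma Mseq_base_row (r r' : cell_row) rs (b : bitseq) :
  path (next_row bl) r (r' :: rs) -> r'.1.1 = Dn -> size b = r.2 ->
  Mseq (mask b (row_cells r) ++ strip_cells (r' :: rs)) =
  Mseq (mask (map negb b) (row_cells r') ++ strip_cells rs).
Proof.
move=> pr r'Dn br; have := pr => /= /andP[]; rewrite /next_row r'Dn /=.
case/andP=> _ /and3P[/eqP rUp /eqP pE /eqP wE] pr'.
apply: (@Mseq_parallel d); rewrite ?size_row_cells //.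
  exact: uniq_strip pr.
move=> i z ir zin; rewrite !nth_row_cells ?wE // rUp r'Dn pE.
apply: share_edge_base; rewrite diag_shift.
move: zin; rewrite !mem_cat => /or3P[/mem_row_cells[-> ->]|/mem_row_cells[-> ->]|zin].
- by left.
- by right; left; rewrite r'Dn /cdiag pE.
right; right; have := strip_below pr' zin.
by rewrite /below /cdiag /= r'Dn pE diag_shift.
Qed.

Lemma Mseq_up_row (r r' : cell_row) rs (b : bitseq) :
  path (next_row bl) r (r' :: rs) -> r'.1.1 != Dn -> ~~ bl r.1 -> size b = r.2 ->
  Mseq (mask b (row_cells r) ++ strip_cells (r' :: rs)) =
  up (fun t => Mseq (mask (map negb t) (row_cells r') ++ strip_cells rs)) b.
Proof.
move=> pr r'Dn wr br; have := pr => /= /andP[].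
rewrite /next_row (negPf r'Dn) (negPf wr) /=.
case/and3P=> _ rUp /andP[/eqP pE /eqP wE] pr'.
rewrite /up br -wE -(size_row_cells r') -[strip_cells (r' :: rs)]/(row_cells r' ++ _).
rewrite -(@Mseq_zigzag d _ (row_cells r) _ _ false) ?drop0 //;
  rewrite ?size_row_cells //; [by right|exact: uniq_strip pr|].
move=> i z ir zin.
rewrite !nth_row_cells ?wE ?ltnS ?(ltnW ir) // ir /= pE.
rewrite -east_shiftE -south_shift; apply: share_edge_step; rewrite // diag_shift.
move: zin; rewrite !mem_cat => /or3P[/mem_row_cells[-> ->]|/mem_row_cells[-> ->]|zin].
- by left.
- by right; left; rewrite /cdiag pE /diag /south_of /=; split=> //; lia.
right; right; have := strip_below pr' zin.
by rewrite /below /cdiag /= pE south_shift diag_shift.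
Qed.

(** The first black cell can only use the first white cell. Treating it separately leaves two rows
    of equal length for [Mseq_zigzag]. *)
Lemma Mseq_down_row (r r' : cell_row) rs (b : bitseq) :
  path (next_row bl) r (r' :: rs) -> r'.1.1 != Dn -> bl r.1 -> size b = r.2 ->
  Mseq (mask (map negb b) (row_cells r) ++ strip_cells (r' :: rs)) =
  down (fun t => Mseq (mask t (row_cells r') ++ strip_cells rs)) b.
Proof.
move=> pr r'Dn wr; case: b => [|a b] br; have := pr => /= /andP[];
  rewrite /next_row (negPf r'Dn) wr /=; case/and3P=> _ rUp /andP[/eqP pE /eqP wE] pr'.
  by rewrite -br in wE.
have bw : size b = r'.2 by move: br; rewrite /= -wE => -[].
have adj i z : (i < r.2)%N -> z \in strip_cells [:: r, r' & rs] ->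
    share_edge (r.1.1, shift r.1.2 i) z =
    (z == (r'.1.1, south_of (shift r.1.2 i))) || (z == (r'.1.1, shift r'.1.2 i)).
  move=> ir zin; rewrite pE -east_shift; apply: share_edge_step; rewrite // diag_shift.
  move: zin; rewrite !mem_cat => /or3P[/mem_row_cells[-> ->]|/mem_row_cells[-> ->]|zin].
  - by left.
  - by right; left; rewrite /cdiag pE /diag /east_of /=; split=> //; lia.
  right; right; have := strip_below pr' zin.
  by rewrite /below /cdiag /= pE south_shift diag_shift diag_east_south.
have in_row z : z \in strip_cells [:: r, r' & rs] -> z.1 = r'.1.1 ->
    cdiag z = diag r'.1.2 -> z \in row_cells r'.
  move=> zin zs zd; move: zin; rewrite !mem_cat => /or3P[|//|zin].
    case/mem_row_cells=> _; rewrite zd pE diag_east_south /cdiag /diag /=; lia.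
  have := strip_below pr' zin; rewrite /below zd zs /cdiag ltxx eqxx /=.
  by rewrite (negPf r'Dn) andbF.
(* At either end of the black row, one of the two candidates falls outside the row below. *)
have {}adj i z : (i < r.2)%N -> z \in strip_cells [:: r, r' & rs] ->
    share_edge (r.1.1, shift r.1.2 i) z =
    (0 < i)%N && (z == nth d (row_cells r') i.-1)
    || (i < r'.2)%N && (z == nth d (row_cells r') i).
  move=> ir zin; rewrite adj //.
  have diag_r' k : cdiag (r'.1.1, shift r'.1.2 k) = diag r'.1.2.
    by rewrite /cdiag diag_shift.
  congr (_ || _).
    case: i ir => [|i] ir /=.
      apply/eqP=> zE; have := in_row z zin; rewrite zE /=.
      rewrite /cdiag /= south_shift diag_shift pE diag_east_south.
      case/(_ erefl erefl)/row_cellsP => k _; rewrite pE => -[h _].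
      by move: h; rewrite /shift /south_of /east_of /=; lia.
    by rewrite nth_row_cells; [rewrite pE south_shiftS|rewrite -wE in ir].
  case: (ltnP i r'.2) => ir' /=; first by rewrite nth_row_cells.
  apply/eqP=> zE; have := in_row z zin; rewrite zE diag_r'.
  case/(_ erefl erefl)/row_cellsP => k kr' /(congr1 snd)/shift_inj ik.
  by rewrite -ik ltnNge ir' in kr'.
have U := uniq_strip pr.
have rE : row_cells r = nth d (row_cells r) 0 :: behead (row_cells r).
  by have := size_row_cells r; rewrite -wE; case: (row_cells r).
set x := nth d _ _ in rE; set xs := behead _ in rE.
have xsz : size xs = r'.2 by rewrite size_behead size_row_cells -wE.
have xsE i : (i < r'.2)%N -> nth d xs i = (r.1.1, shift r.1.2 i.+1).
  by move=> ir; rewrite nth_behead nth_row_cells // -wE.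
have xE : x = (r.1.1, shift r.1.2 0) by rewrite /x nth_row_cells // -wE.
have Ux : x \notin xs ++ strip_cells (r' :: rs) /\
    uniq (xs ++ row_cells r' ++ strip_cells rs).
  by move: U; rewrite /strip_cells map_cons /= rE /= => /andP[].
have scan (c : bool) : c ==> (row_cells r' != [::]) ->
    Mseq (mask (map negb b) xs ++ drop c (row_cells r') ++ strip_cells rs) =
    bitsum (size b) (fun t => zigzag_match c (map negb b) t *
      Mseq (mask (map negb t) (row_cells r') ++ strip_cells rs))%N.
  move=> cr; rewrite (@Mseq_zigzag d) ?size_row_cells ?size_map ?xsz ?bw //.
  - by left.
  - by case: Ux.
  move=> i z ir zin; rewrite xsE // adj -?wE //.
  by rewrite /strip_cells map_cons /= rE mem_cat inE -orbA; apply/orP; right;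
     rewrite -mem_cat.
(* Sum over the white cells matched upwards instead of the particles; by [zigzag_matchC] the first
   black cell then becomes the carry. *)
rewrite rE bw (@bitsum_negb _ _) -bw.
rewrite [RHS](@eq_bitsum _ _ (fun t => zigzag_match (~~ a) (map negb b) t *
   Mseq (mask (map negb t) (row_cells r') ++ strip_cells rs))%N); last first.
  move=> t _; rewrite [in RHS]zigzag_matchC; congr (zigzag_match _ _ _ * _)%N.
  by rewrite mapK //; apply: negbK.
case: a br => br /=; first by rewrite -scan // drop0.
case: Ux => xN Uxs.
have subx z : z \in mask (map negb b) xs ++ strip_cells (r' :: rs) ->
    z \in xs ++ strip_cells (r' :: rs).
  by rewrite !mem_cat => /orP[/mem_mask->|->]; rewrite ?orbT.
rewrite (@Mseq_cons x _ (take 1 (row_cells r'))).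
- have := size_row_cells r'; case r'E : (row_cells r') => [|y ys] yw.
    rewrite big_nil; case: b bw {scan subx br} => [|? ?]; last by rewrite -yw.
    by rewrite -yw.
  rewrite [take _ _]/= take0 big_seq1 r'E in scan *.
  rewrite -scan //; apply: eq_Mseq => z.
  rewrite mem_filter /strip_cells map_cons r'E /= drop0 !(mem_cat, inE).
  have [->|//] := eqVneq z y; move: Uxs; rewrite r'E cat_uniq /=.
  rewrite negb_or mem_cat negb_or => /and3P[_ /andP[yx _] /andP[/andP[yys yrs] _]].
  by rewrite (negPf yys) (negPf yrs) (contraNF (@mem_mask _ _ _ _) yx).
- by apply: contra xN; apply: subx.
- by apply: take_uniq; apply: uniq_row_cells.
move=> z; case: (boolP (z \in _ ++ _)) => [/subx zin|] /=.
  rewrite xE adj -?wE //; last first.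
    by rewrite /strip_cells map_cons /= rE /= inE zin orbT.
  rewrite /= -size_row_cells; case: (row_cells r') => //= y ys.
  by rewrite take0 inE.
apply: contraNF => /mem_take zr'; rewrite /strip_cells map_cons /= !mem_cat zr'.
by rewrite orbT.
Qed.

(** Particles are the cells still present in a white row but those already removed from a black row,
    hence the complement. *)
Lemma Mseq_strip r rs (b : bitseq) : path (next_row bl) r rs -> size b = r.2 ->
  Mseq (mask (if bl r.1 then map negb b else b) (row_cells r) ++ strip_cells rs) =
  transfer (ops bl rs) (all_matched (bl (last r rs).1)) b.
Proof.
elim: rs r b => [|r' rs IHrs] r b pr br.
  rewrite cats0 Mseq_last_row /=; last by case: (bl _); rewrite ?size_map.
  rewrite /all_matched; case: (bl _) => //; congr nat_of_bool.
  by rewrite has_map -all_predC; apply: eq_all => c /=; rewrite negbK.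
have := pr => /andP[rr' pr']; have /andP[/eqP blE nE] := rr'.
rewrite /ops /=; case: ifP nE => r'Dn; rewrite ?r'Dn /=.
  case/and3P=> rUp _ /eqP wE.
  rewrite Mseq_base_row ?(eqP r'Dn) //; last by case: (bl _); rewrite ?size_map.
  rewrite -IHrs ?wE // blE; case: (bl r.1) => //=.
  by rewrite mapK //; apply: negbK.
case/andP=> _; case: ifP => blr => /andP[_ /eqP wE].
  rewrite Mseq_down_row ?r'Dn // blE blr /=.
  case: b br => [|a b] br; first by [].
  apply: eq_bitsum => t tb; rewrite -IHrs ?blE ?blr //.
  by rewrite tb; move: br; rewrite -wE /= => -[].
rewrite Mseq_up_row ?blr ?r'Dn // blE blr /=.
apply: eq_bitsum => t tb; rewrite -IHrs ?blE ?blr //.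
by rewrite tb br wE.
Qed.

End Strip.

Section StripCount.
Variables (bl : pred cell) (r : cell_row) (rs : seq cell_row) (R : {fset cell}).
Hypotheses (pr : path (next_row bl) r rs) (r_white : ~~ bl r.1).
Hypothesis RE : R =i strip_cells (r :: rs).

Lemma M_stripE : M R =
  transfer (ops bl rs) (all_matched (bl (last r rs).1)) (nseq r.2 true).
Proof.
rewrite -(Mseq_strip (Sq, (0, 0)) pr) ?size_nseq // (negPf r_white).
rewrite mask_true ?size_row_cells // /Mseq; congr M.
by apply/fsetP=> z; rewrite in_seq_fset RE.
Qed.

Lemma M_strip_black : bl (last r rs).1 -> has id (ops bl rs) -> M R = 0%N.
Proof. by rewrite M_stripE => -> /transfer_full->. Qed.

Lemma M_strip_white : ~~ bl (last r rs).1 ->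
  M R = ((count negb (ops bl rs) == r.2) * 2 ^ inversions (ops bl rs))%N.
Proof. by rewrite M_stripE => /negPf->; apply: transfer_empty. Qed.

End StripCount.

(** * Row widths, numbers of rows and inversions *)

Definition triangle (h : nat) : nat := (h * h.+1)./2.
Arguments triangle : simpl never.

Lemma triangleS h : (triangle h.+1 = triangle h + h.+1)%N.
Proof.
rewrite /triangle.
rewrite (_ : h.+1 * h.+2 = h * h.+1 + h.+1.*2)%N; last by rewrite -muln2; lia.
by rewrite halfD odd_double andbF add0n doubleK.
Qed.

Definition regular_black (bl : pred cell) (r : cell_row) : bool :=
  bl r.1 && (r.1.1 != Dn).

Lemma count_ops bl rs : count id (ops bl rs) = count (regular_black bl) rs.
Proof. by rewrite count_map count_filter; apply: eq_count => r. Qed.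

(** The row entered by the i-th up step has width [r.2 + i] minus the number of earlier down steps,
    that is, of all down steps but the later ones; summed over the up steps, the later ones are the
    inversions. *)
Lemma inversions_ops bl r rs : path (next_row bl) r rs ->
  (\sum_(r' <- rs | regular_black bl r') r'.2
     + count negb (ops bl rs) * count (regular_black bl) rs =
   inversions (ops bl rs) + count (regular_black bl) rs * r.2
     + triangle (count (regular_black bl) rs))%N.
Proof.
elim: rs r => [|r' rs IHrs] r; first by rewrite big_nil.
case/andP=> /andP[/eqP blE nE] pr'.
have := IHrs _ pr'; rewrite big_cons /regular_black /ops /=.
case: ifP nE => r'Dn; rewrite ?r'Dn ?andbT ?andbF /=.
  by case/and3P=> _ _ /eqP->; rewrite ?add0n.
rewrite -/(ops bl rs) blE; case/andP=> _; case: (bl r.1) => /= /andP[_ /eqP wE].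
  by rewrite -wE ?add0n mulnS mulnDl !mul1n; lia.
by rewrite !add1n ?add0n triangleS wE mulnS mul1n mulSn mulnS; lia.
Qed.

(** Down steps leave exactly the black rows of squares or down-pointing triangles; up steps enter
    exactly those of squares or up-pointing triangles. The last term accounts for [r], which is left
    but not entered. *)
Lemma count_rows_balance bl r rs : path (next_row bl) r rs -> (last r rs).1.1 = Up ->
  (count negb (ops bl rs) + count (fun r' => bl r'.1 && (r'.1.1 == Up)) rs =
   count (regular_black bl) rs + count (fun r' => bl r'.1 && (r'.1.1 == Dn)) rs
   + (bl r.1 && (r.1.1 != Up)))%N.
Proof.
elim: rs r => [|r' rs IHrs] r; first by move=> _ /= ->; rewrite eqxx andbF.
case/andP=> /andP[/eqP blE nE] pr' /= lE; have := IHrs _ pr' lE.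
rewrite /regular_black /ops /=.
case: ifP nE => r'Dn; rewrite ?r'Dn ?andbT ?andbF /=.
  case/and3P=> /eqP rUp _ _; rewrite (eqP r'Dn) rUp eqxx blE /=.
  by case: (bl r.1) => /=; lia.
rewrite -/(ops bl rs) blE; case/andP=> -> _; rewrite andbT.
by case: (bl r.1); case: (r'.1.1 == Up) => /=; lia.
Qed.

(** * Colorings *)

Lemma top_drawn l ds : top l ds \in drawn l ds.
Proof. by apply/mapP; exists 0%N; rewrite ?drop0 // mem_iota. Qed.

Lemma ell_drawn l ds : l \in drawn l ds.
Proof.
apply/mapP; exists (size ds); first by rewrite mem_iota /= ltnS leqnn.
by rewrite drop_size addr0.
Qed.

Section Coloring.
Variables (dr : seq int) (bl : pred cell).
Hypothesis bl_proper : proper_coloring dr bl.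

(** The regions of the unit square at [p] that face the rows above ([upper]) and below ([lower]);
    they coincide if the square is not cut. *)
Definition upper (p : point) : cell := (if diag p \in dr then Up else Sq, p).
Definition lower (p : point) : cell := left_of_east dr p.

Lemma left_of_southE p : left_of_south dr p = upper (south_of p).
Proof. by []. Qed.

Lemma fundamental_upper p : fundamental dr (upper p).
Proof. by rewrite /fundamental /is_square /cdiag /=; case: ifP. Qed.

Lemma fundamental_lower p : fundamental dr (lower p).
Proof. by rewrite /fundamental /is_square /cdiag /=; case: ifP. Qed.

Lemma black_upper_south p : bl (upper (south_of p)) = ~~ bl (lower p).
Proof.
apply: bl_proper (fundamental_upper _) (fundamental_lower _) _.
rewrite share_edgeC share_edgeE /= eqxx.
by case: (_ \in _); case: (_ \in _).
Qed.

Lemma black_upper_east p : bl (upper (east_of p)) = ~~ bl (lower p).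
Proof.
apply: bl_proper (fundamental_upper _) (fundamental_lower _) _.
rewrite share_edgeC share_edgeE /= eqxx orbT.
by case: (_ \in _); case: (_ \in _).
Qed.

Lemma black_base p : diag p \in dr -> bl (lower p) = ~~ bl (upper p).
Proof.
move=> pdr; apply: bl_proper (fundamental_lower _) (fundamental_upper _) _.
by rewrite /lower /left_of_east /upper pdr share_edgeE (eqxx p) !orbT.
Qed.

Lemma upper_square p : diag p \notin dr -> upper p = lower p.
Proof. by rewrite /upper /lower /left_of_east => /negPf->. Qed.

(** Consecutive cells of a row touch a common cell of the row below. *)
Lemma black_lower_shift p k : bl (lower (shift p k)) = bl (lower p).
Proof.
elim: k => [|k IHk]; first by case: p => i j; rewrite /shift /= !addr0.
rewrite -{}IHk; apply: negb_inj; rewrite -black_upper_south -black_upper_east.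
by rewrite south_shiftS east_shift.
Qed.

Lemma black_lower_diag p q : diag p = diag q -> bl (lower p) = bl (lower q).
Proof.
move=> pq; have [le_pq|lt_qp] := lerP p.1 q.1.
  rewrite -(black_lower_shift p `|q.1 - p.1|); congr (bl (lower _)).
  by case: p q pq le_pq => [i j] [k l]; rewrite /diag /shift /= => *; congr (_, _); lia.
rewrite -(black_lower_shift q `|p.1 - q.1|); congr (bl (lower _)).
by case: p q pq lt_qp => [i j] [k l]; rewrite /diag /shift /= => *; congr (_, _); lia.
Qed.

Lemma black_diag x y : fundamental dr x -> fundamental dr y ->
  x.1 = y.1 -> cdiag x = cdiag y -> bl x = bl y.
Proof.
case: x y => s p [t q] fx fy /= st; rewrite /cdiag /= => pq; subst t.
have lo := black_lower_diag pq.
have [|] := boolP (diag p \in dr) => pdr; last first.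
  have sE : s = Sq by move: fx; rewrite /fundamental /cdiag /= pdr => /eqP/eqP.
  by move: lo; rewrite /lower /left_of_east -pq (negPf pdr) sE.
have qdr : diag q \in dr by rewrite -pq.
case: s fx fy => fx fy.
- by move: fx; rewrite /fundamental /cdiag /= pdr.
- move: lo; rewrite !black_base // => /negb_inj.
  by rewrite /upper pdr qdr.
by move: lo; rewrite /lower /left_of_east pdr qdr.
Qed.

(** The regions left of the two possible steps share an edge, so their colours differ and the step
    is forced. *)
Lemma colored_stepE b p q : colored_step dr bl b p q ->
  q = if bl (lower p) == b then east_of p else south_of p.
Proof.
rewrite /colored_step left_of_southE black_upper_south -/(lower p).
by case/orP=> /andP[/eqP-> /eqP<-]; rewrite ?eqxx //; case: (bl _).
Qed.

End Coloring.

(** * Douglas regions *)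

Lemma mem_row_cellsE r z : (z \in row_cells r) =
  [&& z.1 == r.1.1, cdiag z == cdiag r.1 & r.1.2.1 <= z.2.1 < r.1.2.1 + r.2%:Z].
Proof.
case: r z => [[s [i j]] n] [t [u v]]; apply/row_cellsP/and3P => /=.
  by case=> k kn [-> -> ->]; rewrite /cdiag /diag /=; split=> //; lia.
case=> /eqP-> /eqP; rewrite /cdiag /diag /= => d le.
exists `|u - i|%N; first by lia.
by congr (_, (_, _)); rewrite /shift /=; lia.
Qed.

Lemma vertexP (x : cell) (v : point) : v \in vertices x ->
  [\/ diag v = diag x.2 /\ x.2.1 <= v.1 <= x.2.1 + 1,
   [/\ x.1 != Up, diag v = diag x.2 - 1 & v.1 = x.2.1 + 1]
   | [/\ x.1 != Dn, diag v = diag x.2 + 1 & v.1 = x.2.1]].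
Proof.
have same i k : [/\ diag (i, k) = diag (i, k) & i <= (i, k).1 <= i + 1] by split=> //=; lia.
have opp i k : diag (i + 1, k + 1) = diag (i, k) /\ i <= i + 1 <= i + 1.
  by rewrite /diag /=; split; lia.
have se i k : diag (i + 1, k) = diag (i, k) - 1 by rewrite /diag /=; lia.
have nw i k : diag (i, k + 1) = diag (i, k) + 1 by rewrite /diag /=; lia.
case: x => -[] [i k] /=; rewrite !inE.
- case/or4P=> /eqP->; [constructor 1|constructor 2|constructor 1|constructor 3];
  by have [] := opp i k; have [] := same i k; split.
- case/or3P=> /eqP->; [constructor 1|constructor 1|constructor 3];
  by have [] := opp i k; have [] := same i k; split.
case/or3P=> /eqP->; [constructor 1|constructor 2|constructor 1];
by have [] := opp i k; have [] := same i k; split.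
Qed.

Lemma path_below_total bl r rs : path (next_row bl) r rs ->
  {in r :: rs &, forall r1 r2, [\/ r1 = r2, below r1.1 r2.1 | below r2.1 r1.1]}.
Proof.
elim: rs r => [|r' rs IHrs] r pr r1 r2.
  by rewrite !inE => /eqP-> /eqP->; constructor 1.
have bel := path_below pr; have pr' : path (next_row bl) r' rs by case/andP: pr.
rewrite [r1 \in _]inE [r2 \in _]inE.
case/orP=> [/eqP->|r1in] /orP[/eqP->|r2in].
- by constructor 1.
- by constructor 2; apply: bel.
- by constructor 3; apply: bel.
exact: IHrs pr' _ _ r1in r2in.
Qed.

Lemma uniq_path_rows bl r rs : path (next_row bl) r rs -> uniq (r :: rs).
Proof.
elim: rs r => [|r' rs IHrs] r pr //.
rewrite cons_uniq IHrs ?andbT; last by case/andP: pr.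
apply/negP=> /(path_below pr); rewrite /below ltxx eqxx /=.
by case: (r.1.1).
Qed.

Section Geometry.
Variables (a : nat) (ds : seq nat) (D : douglas_region a ds).
Hypotheses (a_gt0 : (0 < a)%N) (len_gt0 : (0 < sumn ds)%N).

Let dr := drawn (ell D) ds.
Let tp := top (ell D) ds.
Let N := sumn ds.
Let L j := nth (ptA D) (ptA D :: lpath D) j.
Let R j := nth (ptF D) (ptF D :: rpath D) j.
Let bl := black D.
Let bl_proper : proper_coloring dr bl := black_proper (d:=D).

Let diag_step b p q : colored_step dr bl b p q -> diag q = diag p - 1.
Proof.
move/(colored_stepE bl_proper) => ->; case: p => i j.
by case: ifP => _; rewrite /diag /=; lia.
Qed.

Let diag_path b p s : path (colored_step dr bl b) p s ->
  (forall j, (j <= size s)%N -> diag (nth p (p :: s) j) = diag p - j%:Z).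
Proof.
elim: s p => [|q s IHs] p /=; first by move=> _ [|//] _; rewrite subr0.
case/andP=> /diag_step qE /IHs h [|j] js /=; first by rewrite subr0.
by rewrite (set_nth_default q) ?h //= qE; lia.
Qed.

Let size_paths : size (lpath D) = N /\ size (rpath D) = N.
Proof.
have tpE : tp = ell D + N%:Z by [].
have dF : diag (ptF D) = tp.
  by rewrite /tp -(ptA_top D) /ptF /diag /=; case: (ptA D) => i j /=; lia.
split.
  have := diag_path (lpath_black D) (leqnn _).
  rewrite (_ : nth _ _ _ = last (ptA D) (lpath D)); last by rewrite nth_last.
  by rewrite lpath_end ptA_top -/tp tpE; lia.
have := diag_path (rpath_white D) (leqnn _).
rewrite (_ : nth _ _ _ = last (ptF D) (rpath D)); last by rewrite nth_last.
by rewrite rpath_end dF tpE; lia.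
Qed.

Let diagL j : (j <= N)%N -> diag (L j) = tp - j%:Z.
Proof.
by move=> jN; rewrite (diag_path (lpath_black D)) ?ptA_top // size_paths.1.
Qed.

Let diagR j : (j <= N)%N -> diag (R j) = tp - j%:Z.
Proof.
move=> jN; rewrite (diag_path (rpath_white D)) ?size_paths.2 //.
by rewrite /tp -(ptA_top D) /ptF /diag /=; case: (ptA D) => i k /=; lia.
Qed.

Let stepL j : (j < N)%N ->
  L j.+1 = if bl (lower dr (L j)) then east_of (L j) else south_of (L j).
Proof.
move=> jN; have := lpath_black D => /(pathP (ptA D))/(_ j).
by rewrite size_paths.1 => /(_ jN)/(colored_stepE bl_proper); rewrite eqb_id.
Qed.

Let stepR j : (j < N)%N ->
  R j.+1 = if bl (lower dr (L j)) then south_of (R j) else east_of (R j).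
Proof.
move=> jN; have := rpath_white D => /(pathP (ptF D))/(_ j).
rewrite size_paths.2 => /(_ jN)/(colored_stepE bl_proper).
rewrite eqbF_neg (black_lower_diag bl_proper (p := R j) (q := L j)).
  by rewrite if_neg.
by rewrite diagL ?diagR // ltnW.
Qed.

Let w j : nat := `|(R j).1 - (L j).1|%N.

Let L_neq_R j : (j <= N)%N -> L j != R j.
Proof.
move=> jN; apply: contraNneq (paths_disjoint D) => LR; apply/hasP.
exists (R j); first by rewrite mem_nth //= size_paths.2.
by rewrite /= -LR mem_nth //= size_paths.1.
Qed.

(** The gap starts at [a], changes by one at each step and never vanishes, the paths being disjoint;
    so it stays positive. *)
Let L_lt_R j : (j <= N)%N -> (L j).1 < (R j).1.
Proof.
elim: j => [|j IHj] jN; first by rewrite /L /R /= /ptF /=; lia.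
have := IHj (ltnW jN); have := L_neq_R jN; have := diagL jN; rewrite -(diagR jN).
rewrite stepL // stepR //; case: (L j) (R j) => [i k] [i' k'].
by case: (bl _); rewrite /diag /= xpair_eqE /=; lia.
Qed.

Let RE j : (j <= N)%N -> (R j).1 = (L j).1 + (w j)%:Z.
Proof. by move/L_lt_R; rewrite /w; lia. Qed.

Let w_gt0 j : (j <= N)%N -> (0 < w j)%N.
Proof. by move/L_lt_R; rewrite /w; lia. Qed.

Let wS j : (j < N)%N ->
  if bl (lower dr (L j)) then (w j.+1).+1 = w j else w j.+1 = (w j).+1.
Proof.
move=> jN; have := RE jN; have := RE (ltnW jN); rewrite stepL // stepR //.
case: (L j) (R j) => [i k] [i' k'].
by case: (bl _) => /=; lia.
Qed.

Let up_row j : cell_row := (upper dr (L j), w j).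
Let lo_row j : cell_row := (lower dr (L j), w j).

(** On the lowest diagonal only the triangles above it belong to the region; the top row [lo_row 0]
    is kept apart as head of the strip. *)
Definition rows_at (j : nat) : seq cell_row :=
  if j == N then [:: up_row j]
  else if diag (L j) \in dr then [:: up_row j; lo_row j] else [:: lo_row j].

Definition lower_rows : seq cell_row := flatten [seq rows_at j | j <- iota 1 N].

Let next_up j : (j < N)%N -> next_row bl (lo_row j) (up_row j.+1).
Proof.
move=> jN; have := wS jN; have := stepL jN; rewrite /next_row.
have -> : bl (up_row j.+1).1 = ~~ bl (lo_row j).1.
  rewrite /= stepL //; case: ifP => b; rewrite -[X in ~~ X]b.
    exact: black_upper_east.
  exact: black_upper_south.
have -> : ((up_row j.+1).1.1 == Dn) = false by rewrite /=; case: ifP.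
have -> : ((lo_row j).1.1 != Up) by rewrite /=; case: ifP.
rewrite -[(lo_row j).1]/(lower dr (L j)) eqxx.
by case: (bl (lower dr (L j))) => /= -> ->; rewrite !eqxx.
Qed.

Let next_lo j : diag (L j) \in dr -> next_row bl (up_row j) (lo_row j).
Proof.
move=> jdr; rewrite /next_row /= -/(upper dr (L j)) -/(lower dr (L j)).
by rewrite (black_base bl_proper jdr) jdr !eqxx.
Qed.

Let path_rows_from j n : (j + n = N)%N ->
  path (next_row bl) (lo_row j) (flatten [seq rows_at k | k <- iota j.+1 n]).
Proof.
elim: n j => [|n IHn] j jn //=; rewrite cat_path /rows_at.
have jN : (j < N)%N by lia.
have nx := next_up jN; have {IHn} := IHn j.+1; rewrite addSnnS => /(_ jn) IHn.
case: eqP => [jE|_].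
  have -> : n = 0%N by lia.
  by rewrite /= nx.
have [jdr|jdr] := boolP (_ \in dr) => /=; first by rewrite nx next_lo.
by rewrite -[lo_row j.+1]/(lower dr (L j.+1), _) -(upper_square jdr) in IHn *; rewrite nx.
Qed.

Lemma path_rows : path (next_row bl) (lo_row 0) lower_rows.
Proof. exact: path_rows_from. Qed.

Let betweenP p : reflect
  (exists j, [/\ (j <= N)%N, diag p = tp - j%:Z & (L j).1 <= p.1 <= (R j).1])
  (between (ptA D :: lpath D) (ptF D :: rpath D) p).
Proof.
have szL : size (ptA D :: lpath D) = N.+1 by rewrite /= size_paths.1.
have szR : size (ptF D :: rpath D) = N.+1 by rewrite /= size_paths.2.
apply: (iffP andP) => [[/hasP[q /(nthP (ptA D))[j]]]|[j [jN pd /andP[Lp pR]]]].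
  rewrite szL ltnS -/(L j) => jN <- /andP[/eqP dp Lp].
  case/hasP=> q' /(nthP (ptF D))[k]; rewrite szR ltnS -/(R k).
  move=> kN <- /andP[/eqP dp' pR]; exists j.
  have jk : j = k by move: dp dp'; rewrite diagL // diagR //; lia.
  by rewrite -dp diagL //; subst k; rewrite Lp pR.
split; apply/hasP.
  exists (L j); first by rewrite mem_nth //= size_paths.1.
  by rewrite diagL // pd eqxx.
exists (R j); first by rewrite mem_nth //= size_paths.2.
by rewrite diagR // pd eqxx.
Qed.

Let stripP (x : cell) : reflect
  (exists j, [/\ (j <= N)%N, fundamental dr x, cdiag x = tp - j%:Z,
     (L j).1 <= x.2.1 < (R j).1 & ((j == 0%N) ==> (x.1 == Dn)) && ((j == N) ==> (x.1 == Up))])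
  (x \in strip_cells (lo_row 0 :: lower_rows)).
Proof.
rewrite /strip_cells map_cons /= mem_cat.
have top_dr : diag (L 0) \in dr by rewrite diagL // subr0; apply: top_drawn.
have ell_dr : diag (L N) \in dr.
  by rewrite diagL // /tp /top addrK; apply: ell_drawn.
apply: (iffP orP) => [[|/flatten_mapP[r /flatten_mapP[j]]]|].
- rewrite mem_row_cellsE /= -RE // top_dr => /and3P[/eqP x1 /eqP xd xL].
  exists 0%N; split=> //; last by rewrite x1 [0%N == N]eq_sym [N == _]gtn_eqF.
    by rewrite /fundamental /is_square x1 xd /cdiag /= top_dr.
  by rewrite xd /cdiag /= diagL.
- rewrite mem_iota add1n ltnS => /andP[j0 jN] rj; rewrite mem_row_cellsE.
  have rE : [/\ r.1.2 = L j, r.2 = w j, fundamental dr r.1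
      & (j == N) ==> (r.1.1 == Up)].
    move: rj; rewrite /rows_at; case: eqP => [->|_].
      rewrite inE => /eqP->; split=> //; first exact: fundamental_upper.
      by rewrite /= ell_dr.
    have rin : r \in [:: up_row j; lo_row j] ->
        [/\ r.1.2 = L j, r.2 = w j & fundamental dr r.1].
      rewrite !inE => /orP[]/eqP->; split=> //; first exact: fundamental_upper.
      exact: fundamental_lower.
    case: ifP => _ h; have [|-> -> ->] // := rin _.
    by move: h; rewrite !inE => ->; rewrite orbT.
  case: rE => r12 r2 rf ru; rewrite r12 r2 -RE // => /and3P[/eqP x1 /eqP xd xL].
  exists j; split=> //.
  + by move: rf; rewrite /fundamental /is_square x1 xd.
  + by rewrite xd /cdiag r12 diagL.
  by rewrite x1 ru andbT; case: (j) j0.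
case=> j [jN xf xd xLR /andP[j0 jNx]].
have xj : cdiag x = diag (L j) by rewrite xd diagL.
have xs : (diag (L j) \in dr) = (x.1 != Sq).
  by move: xf; rewrite /fundamental /is_square xj; case: (x.1); case: (_ \in _).
case: (posnP j) => jp; [left|right].
  subst j; rewrite mem_row_cellsE -RE //; apply/and3P; split=> //.
    by rewrite /= top_dr; apply: (implyP j0).
  exact/eqP.
apply/flatten_mapP; exists ((x.1, L j), w j); last first.
  rewrite mem_row_cellsE -RE //; apply/and3P; split=> //; exact/eqP.
apply/flatten_mapP; exists j; first by rewrite mem_iota add1n ltnS jp.
rewrite /rows_at; case: eqP => [jE|_].
  by rewrite inE /up_row /upper xs; move: jNx; rewrite jE eqxx => /eqP->.
by rewrite /up_row /lo_row /upper /lower /left_of_east xs; case: (x.1);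
   rewrite !inE ?eqxx ?orbT.
Qed.

Let L_mono j : (j < N)%N -> (L j).1 <= (L j.+1).1 <= (L j).1 + 1.
Proof. by move/stepL->; case: (L j) => i k; case: (bl _) => /=; lia. Qed.

Let R_mono j : (j < N)%N -> (R j).1 <= (R j.+1).1 <= (R j).1 + 1.
Proof. by move/stepR->; case: (R j) => i k; case: (bl _) => /=; lia. Qed.

(** The two corners on the cell's own diagonal decide: the paths move by 0 or 1 in abscissa between
    adjacent diagonals, so the other corners follow. On the extreme diagonals a corner beyond the
    strip excludes the outer triangles. *)
Lemma region_rows : region D =i strip_cells (lo_row 0 :: lower_rows).
Proof.
move=> x; rewrite regionE -/dr; apply/andP/stripP.
  case=> xf vx; have base p : p \in vertices x -> exists j,
      [/\ (j <= N)%N, diag p = tp - j%:Z & (L j).1 <= p.1 <= (R j).1].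
    by move=> px; apply/betweenP; apply: (allP vx).
  have [j [jN xd xL]] : exists j,
      [/\ (j <= N)%N, diag x.2 = tp - j%:Z & (L j).1 <= x.2.1 <= (R j).1].
    by apply: base; case: (x) => -[] [i k]; rewrite /= !inE eqxx.
  have [j' [j'N xd' xR]] : exists j,
      [/\ (j <= N)%N, diag (shift x.2 1) = tp - j%:Z
        & (L j).1 <= (shift x.2 1).1 <= (R j).1].
    by apply: base; case: (x) => -[] [i k]; rewrite /shift /= !inE eqxx ?orbT.
  have jj' : j' = j by move: xd'; rewrite diag_shift xd; lia.
  subst j'; exists j; split=> //; first by
    case/andP: xL xR => -> _ /andP[_]; rewrite /shift /= lezD1.
  have top_dr : tp \in dr by apply: top_drawn.
  have ell_dr : tp - N%:Z \in dr by rewrite /tp /top addrK; apply: ell_drawn.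
  apply/andP; split; apply/implyP => /eqP jE; subst j.
    move: xf xd base; case: (x) => -[] [i k]; rewrite /fundamental /cdiag //= subr0.
      by move=> + xd; rewrite xd top_dr.
    move=> _ xd /(_ (i, k + 1)); rewrite !inE eqxx !orbT => /(_ isT)[j [_ + _]].
    by rewrite -xd /diag /=; lia.
  move: xf xd base; case: (x) => -[] [i k]; rewrite /fundamental /cdiag //=.
    by move=> + xd; rewrite xd ell_dr.
  move=> _ xd /(_ (i + 1, k)); rewrite !inE eqxx !orbT => /(_ isT)[j [jN' + _]].
  by move: xd; rewrite /diag /=; lia.
case=> j [jN xf xd xLR /andP[j0 jNx]]; split=> //; apply/allP => v vx.
apply/betweenP.
have {vx} := vertexP vx; move: xLR => /andP[Lx xR].
move: xd; rewrite /cdiag => xd; case=> [[vd /andP[xv vx]]|[nUp vd vx]|[nDn vd vx]].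
- exists j; split; rewrite ?vd // (le_trans Lx xv) (le_trans vx) // lezD1.
  exact: xR.
- have j_lt : (j < N)%N.
    by rewrite ltn_neqAle jN andbT; apply: contra nUp => /(implyP jNx).
  exists j.+1; split=> //; first by rewrite vd xd; lia.
  have /andP[_ L1] := L_mono j_lt; have /andP[R1 _] := R_mono j_lt.
  by rewrite vx (le_trans L1) ?lerD2r //= (le_trans _ R1) // lezD1.
have jp : (0 < j)%N by rewrite lt0n; apply: contra nDn => /(implyP j0).
have j_lt : (j.-1 < N)%N by rewrite prednK.
exists j.-1; split; [exact: ltnW | by rewrite vd xd; lia |].
have := L_mono j_lt; have := R_mono j_lt; rewrite prednK //.
move=> /andP[_ R1] /andP[L1 _].
rewrite vx; apply/andP; split; first exact: le_trans Lx.
by rewrite -(lerD2r 1); apply: le_trans R1; rewrite lezD1.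
Qed.

Lemma rows_pos : {in lo_row 0 :: lower_rows, forall r, 0 < r.2}%N.
Proof.
move=> r; rewrite inE => /orP[/eqP->|]; first exact: w_gt0.
case/flatten_mapP=> j; rewrite mem_iota add1n ltnS => /andP[_ jN].
have wj : {in [:: up_row j; lo_row j], forall r0, r0.2 = w j}.
  by move=> r0; rewrite !inE => /orP[]/eqP->.
move=> rj; rewrite wj ?w_gt0 //; move: rj; rewrite /rows_at.
by case: ifP => _; [|case: ifP => _]; rewrite !inE // => ->; rewrite ?orbT.
Qed.

Lemma last_row : last (lo_row 0) lower_rows = up_row N.
Proof.
have iotaE n : (0 < n)%N -> iota 1 n = rcons (iota 1 n.-1) n.
  by case: n => // n _; rewrite -[n.+1 in LHS]addn1 iotaD cats1 add1n.
rewrite /lower_rows iotaE // map_rcons flatten_rcons last_cat /rows_at eqxx.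
by [].
Qed.

Let rows := lo_row 0 :: lower_rows.

Let region_fundamental x : x \in region D -> fundamental dr x.
Proof. by rewrite regionE => /andP[]. Qed.

Let black_row r z : r \in rows -> z \in row_cells r -> bl z = bl r.1.
Proof.
move=> rr zr; have r0 : r.1 \in row_cells r.
  by rewrite mem_row_cellsE !eqxx lexx ltrDl ltz_nat rows_pos.
have inD y : y \in row_cells r -> y \in region D.
  by move=> yr; rewrite region_rows; apply/flatten_mapP; exists r.
have [zs zd] := mem_row_cells zr.
by apply: (black_diag bl_proper) => //; apply/region_fundamental/inD.
Qed.

(** Only the two rows of triangles on one drawn diagonal could be confused by [same_row], and their
    colours differ. *)
Let row_inj : {in rows &, injective (fun r => row_of D r.1)}.
Proof.
have head r : r \in rows -> r.1 \in region D.
  move=> rr; rewrite region_rows; apply/flatten_mapP; exists r => //.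
  by rewrite mem_row_cellsE !eqxx lexx ltrDl ltz_nat rows_pos.
have not_same r r' : r \in rows -> r' \in rows -> below r.1 r'.1 ->
    row_of D r.1 = row_of D r'.1 -> False.
  move=> rr rr' b rE; have : r'.1 \in row_of D r.1.
    by rewrite rE in_fset /= inE head // /same_row !eqxx.
  rewrite in_fset /= inE => /andP[_ /and3P[_ /eqP sb /eqP sd]].
  move: b; rewrite /below sd ltxx eqxx /= => /andP[/eqP rU /eqP r'D].
  have fr := region_fundamental (head _ rr).
  have rdr : diag r.1.2 \in dr.
    by move: fr; rewrite /fundamental /is_square rU /cdiag; case: (_ \in dr).
  have urE : upper dr r.1.2 = r.1 by rewrite /upper rdr -rU -surjective_pairing.
  have bE : bl r'.1 = bl (lower dr r.1.2).
    apply: (black_diag bl_proper); rewrite ?fundamental_lower //.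
    - by rewrite region_fundamental ?head.
    - by rewrite r'D /= rdr.
  have := black_base bl_proper rdr; rewrite urE -bE.
  by move: sb; rewrite -/bl => ->; case: (bl _).
move=> r r' rr rr' rE; case: (path_below_total path_rows rr rr') => // b.
  by case: (not_same r r').
by case: (not_same r' r).
Qed.

Let nb_rowsE (P : pred cell) :
  {in rows, forall r, {in row_cells r, forall z, P z = P r.1}} ->
  nb_rows D P = count (fun r => P r.1) rows.
Proof.
move=> PE; rewrite /nb_rows.
have -> : [fset row_of D x | x in region D & P x]%fset =
    [fset z in [seq row_of D r.1 | r <- rows & P r.1]]%fset.
  apply/fsetP=> z; rewrite in_seq_fset; apply/imfsetP/mapP => [[x]|[r]].
    rewrite inE => /andP[xD Px] ->; move: (xD); rewrite region_rows.
    case/flatten_mapP=> r rr xr; exists r; first by rewrite mem_filter rr -(PE r rr _ xr) Px.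
    have [xs xd] := mem_row_cells xr.
    apply/fsetP=> y; rewrite !in_fset /= !inE /same_row /is_square xs xd.
    by rewrite -/bl (black_row rr xr).
  rewrite mem_filter => /andP[Pr rr] ->; exists r.1 => //; rewrite inE Pr andbT.
  rewrite region_rows; apply/flatten_mapP; exists r => //.
  by rewrite mem_row_cellsE !eqxx lexx ltrDl ltz_nat rows_pos.
rewrite card_fseq undup_id ?size_map ?size_filter // map_inj_in_uniq.
  exact/filter_uniq/uniq_path_rows/path_rows.
by move=> r r'; rewrite !mem_filter => /andP[_ rr] /andP[_ rr']; apply: row_inj.
Qed.

Let row_statP (Q : bool -> Defs.shape -> bool) r z :
  r \in rows -> z \in row_cells r -> Q (bl z) z.1 = Q (bl r.1) r.1.1.
Proof.
by move=> rr zr; rewrite (black_row rr zr); have [-> _] := mem_row_cells zr.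
Qed.

Let first_white : ~~ bl (lo_row 0).1.
Proof.
have d0 : diag (L 0) = tp by rewrite diagL // subr0.
rewrite -[(lo_row 0).1]/(lower dr (L 0)) /lower /left_of_east d0 top_drawn.
exact: top_white.
Qed.

Let last_up : (last (lo_row 0) lower_rows).1.1 = Up.
Proof. by rewrite last_row /up_row [LHS]/= /upper diagL // /tp /top addrK ell_drawn. Qed.

Let count_black_rows (Q : pred cell_row) :
  count (fun r => bl r.1 && Q r) rows = count (fun r => bl r.1 && Q r) lower_rows.
Proof.
transitivity ((bl (lo_row 0).1 && Q (lo_row 0)) +
              count (fun r => bl r.1 && Q r) lower_rows)%N; first by [].
by rewrite (negPf first_white).
Qed.

Lemma heightE : height D = count (regular_black bl) lower_rows.
Proof.
rewrite /height nb_rowsE => [|r rr z zr]; last first.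
  exact: (row_statP (fun b s => b && ((s == Sq) || (s == Up))) rr zr).
rewrite (count_black_rows (fun r => is_square r.1 || up_pointing r.1)).
apply: eq_count => r; by rewrite /regular_black /is_square /up_pointing; case: (r.1.1).
Qed.

Lemma nb_up_rowsE :
  nb_up_rows D = count (fun r => bl r.1 && (r.1.1 == Up)) lower_rows.
Proof.
rewrite /nb_up_rows nb_rowsE => [|r rr z zr]; last first.
  exact: (row_statP (fun b s => b && (s == Up)) rr zr).
exact: (count_black_rows (fun r => r.1.1 == Up)).
Qed.

Lemma nb_down_rowsE :
  nb_down_rows D = count (fun r => bl r.1 && (r.1.1 == Dn)) lower_rows.
Proof.
rewrite /nb_down_rows nb_rowsE => [|r rr z zr]; last first.
  exact: (row_statP (fun b s => b && (s == Dn)) rr zr).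
exact: (count_black_rows (fun r => r.1.1 == Dn)).
Qed.

Lemma nb_regular_blackE :
  (nb_regular_black D = \sum_(r <- lower_rows | regular_black bl r) r.2)%N.
Proof.
pose P x := bl x && ~~ down_pointing x.
have -> : nb_regular_black D = count P (strip_cells rows).
  rewrite -size_filter -(undup_id (filter_uniq P (uniq_strip path_rows))) -card_fseq.
  rewrite /nb_regular_black; congr #|` _|%fset; apply/fsetP=> z.
  by rewrite in_seq_fset mem_filter in_fset /= inE region_rows andbC.
rewrite count_flatten sumnE !big_map /rows big_cons.
have cntE r : r \in rows -> count P (row_cells r) = (regular_black bl r * r.2)%N.
  move=> rr; rewrite -[in RHS]size_row_cells -size_filter.
  have PE : {in row_cells r, P =1 (fun=> regular_black bl r)}.
    by move=> z zr; apply: (row_statP (fun b s => b && (s != Dn)) rr zr).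
  rewrite (eq_in_filter PE); case: (regular_black bl r); last by rewrite filter_pred0.
  by rewrite filter_predT mul1n.
rewrite cntE ?mem_head // /regular_black (negPf first_white) mul0n add0n.
rewrite -/(regular_black bl _) [RHS]big_mkcond !big_seq; apply: eq_bigr => r rr.
by rewrite cntE ?inE ?rr ?orbT // /regular_black; case: ifP; rewrite ?mul1n.
Qed.

Let bottom_cell : (last (lo_row 0) lower_rows).1 \in bottom_row D.
Proof.
have lU := last_up; have lin : last (lo_row 0) lower_rows \in rows by apply: mem_last.
rewrite /bottom_row in_fset /= inE /is_square lU; apply/and3P; split=> //; last first.
  by rewrite last_row /cdiag [(up_row N).1.2]/(L N) diagL // /tp /top addrK.
rewrite region_rows; apply/flatten_mapP; exists (last (lo_row 0) lower_rows) => //.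
by rewrite mem_row_cellsE !eqxx lexx ltrDl ltz_nat rows_pos.
Qed.

(** The row after the white top row is black, so the word has an up step. *)
Let M_last_black : bl (last (lo_row 0) lower_rows).1 -> M D = 0%N.
Proof.
move=> lb; apply: (M_strip_black path_rows first_white region_rows lb).
rewrite has_count count_ops -has_count.
apply/hasP; exists (up_row 1).
  apply/flatten_mapP; exists 1%N; first by rewrite mem_iota /= add1n ltnS.
  rewrite /rows_at; case: eqP => _; first by rewrite inE.
  have [d1|d1] := boolP (diag (L 1) \in dr); first by rewrite inE eqxx.
  by rewrite inE /up_row /lo_row upper_square.
have /andP[/eqP blE _] : next_row bl (lo_row 0) (up_row 1) by apply: next_up.
by rewrite /regular_black -/bl blE first_white /=; case: ifP.
Qed.

Lemma M_bottom_black : bottom_black D -> M D = 0%N.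
Proof. by move/(_ _ bottom_cell)/M_last_black. Qed.

Let first_width : (lo_row 0).2 = a.
Proof. by rewrite /= /w /L /R /= /ptF /=; lia. Qed.

Let nb_down_steps : (count negb (ops bl lower_rows) + nb_up_rows D =
  height D + nb_down_rows D)%N.
Proof.
rewrite heightE nb_up_rowsE nb_down_rowsE.
by rewrite (count_rows_balance path_rows last_up) (negPf first_white) addn0.
Qed.

Lemma M_unbalanced : (height D + nb_down_rows D != a + nb_up_rows D)%N ->
  M D = 0%N.
Proof.
move=> unbal; have [/M_last_black //|lw] := boolP (bl (last (lo_row 0) lower_rows).1).
rewrite (M_strip_white path_rows first_white region_rows lw) first_width.
by case: eqP => // qa; move: unbal; rewrite -nb_down_steps qa eqxx.
Qed.

(** The exponent [e] is the number of inversions: with [a] down steps the products [a * h] in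
    [inversions_ops] cancel. *)
Lemma M_balanced : (height D + nb_down_rows D = a + nb_up_rows D)%N ->
  bottom_white D ->
  exists2 e, nb_regular_black D = (e + triangle (height D))%N & M D = (2 ^ e)%N.
Proof.
move=> bal /(_ _ bottom_cell) lw; exists (inversions (ops bl lower_rows)).
  have := inversions_ops path_rows.
  rewrite -heightE -nb_regular_blackE first_width.
  have -> : count negb (ops bl lower_rows) = a by have := nb_down_steps; lia.
  by rewrite mulnC; lia.
rewrite (M_strip_white path_rows first_white region_rows lw) first_width.
have -> : count negb (ops bl lower_rows) = a by have := nb_down_steps; lia.
by rewrite eqxx mul1n.
Qed.

End Geometry.

(** * The Aztec diamond *)

Lemma triangle_double h : (h * h.+1 = triangle h + triangle h)%N.
Proof. by rewrite /triangle addnn -[LHS]odd_double_half oddM oddS andbN. Qed.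

Section Aztec.
Variable h : nat.

Let bl : pred cell := fun x => odd `|h%:Z - cdiag x|.

(** The left end descends from [(-h, 0)] by alternate steps south and east. *)
Let aztec_row (k : nat) : cell_row :=
  ((Sq, (k./2%:Z - h%:Z, - (uphalf k)%:Z)), (h + odd k)%N).

Let diag_aztec_row k : cdiag (aztec_row k).1 = h%:Z - k%:Z.
Proof. by rewrite /cdiag /diag /=; lia. Qed.

Let bl_aztec_row k : bl (aztec_row k).1 = odd k.
Proof. by rewrite /bl diag_aztec_row; congr odd; lia. Qed.

Let path_aztec k n :
  path (next_row bl) (aztec_row k) [seq aztec_row j | j <- iota k.+1 n].
Proof.
elim: n k => //= n IHn k; rewrite IHn andbT /next_row !bl_aztec_row /= eqxx /=.
by rewrite /south_of /east_of /=; case: ifP; rewrite !xpair_eqE; lia.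
Qed.

Let aztec_rows := [seq aztec_row j | j <- iota 1 h.*2].

Lemma aztec_diamond_rows :
  aztec_diamond h =i strip_cells (aztec_row 0 :: aztec_rows).
Proof.
have -> : aztec_row 0 :: aztec_rows = [seq aztec_row j | j <- iota 0 h.*2.+1] by [].
move=> x; rewrite in_aztec_diamond; apply/idP/flatten_mapP => [|[r]].
  case: x => -[] [i j] // all_x; rewrite /in_diamond /= in all_x.
  exists (aztec_row (absz (h%:Z - (j - i))%R)); first by apply/mapP; exists (absz (h%:Z - (j - i))%R); rewrite // mem_iota; lia.
  by rewrite mem_row_cellsE diag_aztec_row /cdiag /diag /=; lia.
case/mapP=> k; rewrite mem_iota => /andP[_ k_lt] ->.
rewrite mem_row_cellsE diag_aztec_row.
case: x => -[] [i j] //=; rewrite /in_diamond /cdiag /diag /=; lia.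
Qed.

(** The [h] black rows have [h + 1] cells each, twice [triangle h] in all, and [inversions_ops]
    takes one [triangle h] away. *)
Lemma M_aztec_diamond : M (aztec_diamond h) = (2 ^ triangle h)%N.
Proof.
have pr : path (next_row bl) (aztec_row 0) aztec_rows by apply: path_aztec.
have count_odd : count odd (iota 1 h.*2) = h.
  elim: h => // n IHn; rewrite doubleS -addn2 iotaD count_cat IHn /= odd_double /=.
  by rewrite addn0 addn1.
have wh : ~~ bl (aztec_row 0).1 by rewrite bl_aztec_row.
have lw : ~~ bl (last (aztec_row 0) aztec_rows).1.
  rewrite last_map bl_aztec_row; case: (h) => // n.
  by rewrite doubleS -addn2 iotaD last_cat /= negbK oddD odd_double.
have hE : count (regular_black bl) aztec_rows = h.
  rewrite count_map -[RHS]count_odd; apply: eq_count => k /=.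
  by rewrite /regular_black bl_aztec_row andbT.
have opsE : ops bl aztec_rows = [seq odd k | k <- iota 1 h.*2].
  rewrite /ops /aztec_rows; elim: (iota _ _) => //= k s ->.
  by rewrite bl_aztec_row.
have qE : count negb (ops bl aztec_rows) = h.
  have := count_predC id (ops bl aztec_rows); rewrite opsE size_map size_iota.
  rewrite [X in (X + _)%N]count_map count_odd => hh.
  by apply: (@addnI h); rewrite addnn -[RHS]hh.
rewrite (M_strip_white pr wh aztec_diamond_rows lw) qE /= addn0 eqxx mul1n.
congr (2 ^ _)%N; have := inversions_ops pr; rewrite hE qE /= addn0.
have -> : (\sum_(r' <- aztec_rows | regular_black bl r') r'.2 = h * h.+1)%N.
  rewrite big_map (eq_bigl odd) => [|k].
    rewrite (eq_bigr (fun=> h.+1)) => [|k /= ->]; last by rewrite addn1.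
    by rewrite big_const_seq count_odd iter_addn_0 mulnC.
  by rewrite /regular_black bl_aztec_row andbT.
by rewrite triangle_double; lia.
Qed.

End Aztec.

Theorem theorem2p3 (a : nat) (ds : seq nat) (a_gt0 : (0 < a)%N)
    (ds_neq0 : ds != [::]) (ds_gt0 : all (fun d => (0 < d)%N) ds)
    (D : douglas_region a ds) :
  let h := height D in
  let m := nb_up_rows D in
  let n := nb_down_rows D in
  let C := nb_regular_black D in
  (bottom_black D \/ h%:Z <> a%:Z + m%:Z - n%:Z -> M D = 0%N)
  /\
  (h%:Z = a%:Z + m%:Z - n%:Z -> bottom_white D ->
    [/\ (M D)%:R =
          2 ^ (C%:Z - (h * h.+1)%:Z) * 2 ^+ (h * h.+1)./2 :> rat,
        (M D)%:R = 2 ^ (C%:Z - ((h * h.+1)./2)%:Z) :> rat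
      & M (aztec_diamond h) = (2 ^ (h * h.+1)./2)%N]).
Proof.
move=> h m n C.
have len_gt0 : (0 < sumn ds)%N.
  by case: (ds) ds_neq0 ds_gt0 => //= d s _ /andP[d_gt0 _]; rewrite addn_gt0 d_gt0.
have balE : (h%:Z = a%:Z + m%:Z - n%:Z) <-> (h + n = a + m)%N by lia.
split=> [[bb|unbal]|/balE bal bw].
- exact: M_bottom_black.
- by apply: M_unbalanced => //; apply/eqP => /balE.
have [e CE ->] := M_balanced a_gt0 len_gt0 bal bw.
rewrite -/(triangle h); have hh := triangle_double h.
have n2 : (2 : rat) != 0 by [].
have two k : (2 ^ k)%:R = 2 ^ k%:Z :> rat by rewrite natrX.
rewrite two; split; last exact: M_aztec_diamond.
  (* The second factor cancels one of the two halves of [h * h.+1]. *)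
  rewrite -[2 ^+ _]/(2 ^ (triangle h)%:Z) -expfzDr //; congr (2 ^ _).
  by rewrite /C CE hh -/h !PoszD; lia.
by congr (2 ^ _); rewrite /C CE -/h PoszD; lia.
Qed.
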